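(* Let $(A,m,1_A,\sigma)$ be a unital braided algebra over $\mathbb{K}$ and let $\lambda\in\mathbb{K}$. Let $\mathcal{R}_{\sigma,\lambda}(A)=(A\underline{\otimes}T(A),\lozenge_{\sigma,\lambda})$ be the algebra built on $A$ by means of the quantum quasi-shuffle product $\Join_{\sigma,\lambda}$ of the braided algebra $(A,\lambda\cdot m,\sigma)$, and let $P:\mathcal{R}_{\sigma,\lambda}(A)\to\mathcal{R}_{\sigma,\lambda}(A)$ be the linear map defined by $P(a_0\underline{\otimes}u)=1_A\underline{\otimes}(a_0\otimes u)$ for $a_0\in A$, $u\in T^+(A)=\bigoplus_{i\geq 1}A^{\otimes i}$, and $P(a_0\underline{\otimes}\nu)=1_A\underline{\otimes}(\nu\cdot a_0)$ for $a_0\in A$, $\nu\in\mathbb{K}$. Then the pair $(\mathcal{R}_{\sigma,\lambda}(A),P)$ is a Rota-Baxter algebra of weight $\lambda$.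
   Context: $\mathbb{K}$ is a field of characteristic 0; all vector spaces and algebras are over $\mathbb{K}$; algebras are associative but not necessarily unital. $T(V)=\bigoplus_{i\ge 0}V^{\otimes i}$ is the tensor algebra (as a vector space); $\otimes$ is the tensor product inside $T(V)$, and $\underline{\otimes}$ is the tensor product between $T(V)$ (or subspaces of it) and $T(V)$. Rota-Baxter algebra: for $\lambda\in\mathbb{K}$, a pair $(R,P)$ with $R$ an algebra and $P$ a linear endomorphism of $R$ is a Rota-Baxter algebra of weight $\lambda$ if $P(x)P(y)=P(xP(y))+P(P(x)y)+\lambda P(xy)$ for all $x,y\in R$. Braiding: an invertible linear map $\sigma\in\mathrm{End}(V\otimes V)$ with $(\sigma\otimes\mathrm{id}_V)(\mathrm{id}_V\otimes\sigma)(\sigma\otimes\mathrm{id}_V)=(\mathrm{id}_V\otimes\sigma)(\sigma\otimes\mathrm{id}_V)(\mathrm{id}_V\otimes\sigma)$ on $V^{\otimes 3}$. Write $\sigma_i=\mathrm{id}_V^{\otimes i-1}\otimes\sigma\otimes\mathrm{id}_V^{\otimes n-i-1}$ on $V^{\otimes n}$. For $w\in\mathfrak{S}_n$ with reduced expression $w=s_{i_1}\cdots s_{i_l}$ ($s_i$ the transposition of $i,i+1$), put $T^\sigma_w=\sigma_{i_1}\cdots\sigma_{i_l}$ (well defined). The map $\beta:T(V)\underline{\otimes}T(V)\to T(V)\underline{\otimes}T(V)$ has restriction $\beta_{ij}=\beta_{i,j}=T^\sigma_{\chi_{ij}}$ to $V^{\otimes i}\underline{\otimes}V^{\otimes j}$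 for $i,j\ge1$, where $\chi_{ij}\in\mathfrak{S}_{i+j}$ sends $k\mapsto j+k$ for $1\le k\le i$ and $i+k\mapsto k$ for $1\le k\le j$ (so $\beta_{ij}$ maps $V^{\otimes i}\underline{\otimes}V^{\otimes j}$ to $V^{\otimes j}\underline{\otimes}V^{\otimes i}$, $\beta_{11}=\sigma$); $\beta_{0i},\beta_{i0}$ are the identity of $V^{\otimes i}$. Braided algebra: a triple $(A,m,\sigma)$ with $(A,m)$ an algebra and $\sigma$ a braiding on $A$ such that $(\mathrm{id}_A\otimes m)\sigma_1\sigma_2=\sigma(m\otimes\mathrm{id}_A)$ and $(m\otimes\mathrm{id}_A)\sigma_2\sigma_1=\sigma(\mathrm{id}_A\otimes m)$. It is a unital braided algebra if moreover $A$ has a unit $1_A$ with $\sigma(a\otimes1_A)=1_A\otimes a$ and $\sigma(1_A\otimes a)=a\otimes1_A$ for all $a\in A$. Quantum quasi-shuffle product of a braided algebra $(A,m,\sigma)$: the map $\Join_\sigma:T(A)\underline{\otimes}T(A)\to T(A)$ with $\mu\Join_\sigma x=x\Join_\sigma\mu=\mu\cdot x$ for $\mu\in\mathbb{K}$, $x\in T(A)$, and recursively for $a_k,b_k\in A$, $i,j\ge 1$ (writing $\Join_{\sigma(i,j)}$ for the restriction to $A^{\otimes i}\underline{\otimes}A^{\otimes j}$): $(a_1\otimes\cdots\otimes a_i)\Join_\sigma(b_1\otimes\cdots\otimes b_j)=a_1\otimes\big((a_2\otimes\cdots\otimes a_i)\Join_\sigma(b_1\otimes\cdots\otimes b_j)\big)+(\mathrm{id}_A\otimes\Join_{\sigma(i,j-1)})(\beta_{i,1}\otimes\mathrm{id}_A^{\otimes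 j-1})(a_1\otimes\cdots\otimes a_i\otimes b_1\otimes\cdots\otimes b_j)+(m\otimes\Join_{\sigma(i-1,j-1)})(\mathrm{id}_A\otimes\beta_{i-1,1}\otimes\mathrm{id}_A^{\otimes j-1})(a_1\otimes\cdots\otimes a_i\otimes b_1\otimes\cdots\otimes b_j)$, where empty tensors are interpreted as $1\in\mathbb{K}$ (e.g. $a_1\Join_\sigma b_1=a_1\otimes b_1+\sigma(a_1\otimes b_1)+m(a_1\otimes b_1)$). It is known that $(T(A),\Join_\sigma)$ is an associative algebra with unit $1\in\mathbb{K}$. For $\lambda\in\mathbb{K}$, $(A,\lambda\cdot m,\sigma)$ is again a braided algebra; $\Join_{\sigma,\lambda}$ denotes its quantum quasi-shuffle product. $\mathcal{R}_{\sigma,\lambda}(A)$ is the space $A\underline{\otimes}T(A)$ with the product $\lozenge_{\sigma,\lambda}=(m\otimes\Join_{\sigma,\lambda})(\mathrm{id}_A\otimes\beta\otimes\mathrm{id}_{T(A)})$, where $\beta$ is applied to the middle factors $T(A)\underline{\otimes}A$; it is known to be a unital associative algebra. *)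

(* Defs.v *)
From HB Require Import structures.
From mathcomp Require Import all_boot all_order all_fingroup all_algebra.
From mathcomp Require Import finmap boolp classical_sets monalg.

Set Implicit Arguments.
Unset Strict Implicit.
Unset Printing Implicit Defensive.

Import GRing.Theory.
Local Open Scope ring_scope.
Local Open Scope quotient_scope.

(** * Vector spaces given by generators and relations *)

Section Presented.
Variables (K : fieldType) (X : choiceType) (rel : {malg K[X]} -> Prop).

(** The subspace spanned by [rel]. *)
Definition relspan : {pred {malg K[X]}} := fun x =>
  `[< forall S : {pred {malg K[X]}},
        submod_closed S -> (forall r, rel r -> r \in S) -> x \in S >].

Lemma relspan_closed : submod_closed relspan.
Proof.
split; first by apply/asboolP => S [].
move=> a x y /asboolP xS /asboolP yS; apply/asboolP => S clS relS.
by case: (clS) => _; apply; [exact: xS | exact: yS].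
Qed.

HB.instance Definition _ :=
  GRing.isSubmodClosed.Build K {malg K[X]} relspan relspan_closed.

Definition presented : Type := Quotient.quot (relspan : zmodClosed _).

HB.instance Definition _ := GRing.Zmodule.on presented.
HB.instance Definition _ := EqQuotient.on presented.

Definition pres_pi (x : {malg K[X]}) : presented :=
  \pi_(Quotient.quot relspan) x.
Definition pres_repr (x : presented) : {malg K[X]} := generic_quotient.repr x.
Local Notation pi := pres_pi.
Local Notation rep := pres_repr.

Let repK x : pi (rep x) = x. Proof. exact: reprK. Qed.

Let piP x y : pi x = pi y <-> x - y \in relspan.
Proof. by rewrite (Quotient.idealrBE relspan); split=> /eqP. Qed.

Let piB x y : pi (x - y) = pi x - pi y.
Proof. exact: (raddfB (\pi_(Quotient.quot relspan))). Qed.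

Let piD x y : pi (x + y) = pi x + pi y.
Proof. exact: (raddfD (\pi_(Quotient.quot relspan))). Qed.

Definition pres_scale (a : K) (x : presented) : presented := pi (a *: rep x).

Let piZ a x : pi (a *: x) = pres_scale a (pi x).
Proof.
apply/piP; rewrite -scalerBr; apply: rpredZ; apply/piP.
by rewrite repK.
Qed.

Lemma pres_scaleA a b x :
  pres_scale a (pres_scale b x) = pres_scale (a * b) x.
Proof. by rewrite -[x]repK -!piZ scalerA. Qed.

Lemma pres_scale1 : left_id 1 pres_scale.
Proof. by move=> x; rewrite -[x]repK -piZ scale1r. Qed.

Lemma pres_scaleDr : right_distributive pres_scale +%R.
Proof.
by move=> a x y; rewrite -[x]repK -[y]repK -piD -!piZ scalerDr piD.
Qed.

Lemma pres_scaleDl x : {morph pres_scale^~ x : a b / a + b}.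
Proof. by move=> a b /=; rewrite -[x]repK -!piZ scalerDl piD. Qed.

HB.instance Definition _ := GRing.Zmodule_isLmodule.Build K presented
  pres_scaleA pres_scale1 pres_scaleDr pres_scaleDl.

Definition gen (k : X) : presented := pi << k >>.

Definition free_lift (W : lmodType K) (f : X -> W) (x : {malg K[X]}) : W :=
  \sum_(k <- msupp x) x@_k *: f k.

(** Linear extension of a function on the generators, computed on a chosen
representative: it is only meaningful when [f] respects the relations, see
[pres_lift_linear] and [pres_lift_gen]. *)
Definition pres_lift (W : lmodType K) (f : X -> W) (x : presented) : W :=
  free_lift f (rep x).

Lemma free_liftw (W : lmodType K) (f : X -> W) (x : {malg K[X]}) (D : {fset X}) :
  fsubset (msupp x) D -> free_lift f x = \sum_(k <- D) x@_k *: f k.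
Proof.
move=> sxD; rewrite /free_lift.
rewrite (big_fset_incl _ sxD) // => k _ kx.
by rewrite mcoeff_outdom ?scale0r.
Qed.

Lemma free_lift_linear (W : lmodType K) (f : X -> W) : linear (free_lift f).
Proof.
move=> a x y; pose D := fsetU (msupp (a *: x + y)) (fsetU (msupp x) (msupp y)).
rewrite !(@free_liftw W f _ D).
- rewrite scaler_sumr -big_split /=; apply: eq_bigr => k _.
  by rewrite mcoeffD mcoeffZ scalerDl scalerA.
- by rewrite /D fsetUA fsubsetUr.
- by rewrite /D fsetUCA fsubsetUl.
- by rewrite /D fsubsetUl.
Qed.

Lemma free_liftU (W : lmodType K) (f : X -> W) k : free_lift f << k >> = f k.
Proof.
rewrite /free_lift msuppU oner_eq0 big_seq_fset1 mcoeffUU.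
by rewrite scale1r.
Qed.

Section Lift.
Variables (W : lmodType K) (f : X -> W).
Hypothesis f_rel : forall r, rel r -> free_lift f r = 0.

Let lift0 r : r \in relspan -> free_lift f r = 0.
Proof.
move=> /asboolP /(_ [pred x | free_lift f x == 0]) rS; apply/eqP; apply: rS.
  split=> [|a x y]; rewrite !inE.
    by rewrite /free_lift msupp0 big_seq_fset0.
  by move=> /eqP x0 /eqP y0; rewrite free_lift_linear x0 y0 scaler0 addr0.
by move=> x /f_rel x0; rewrite inE x0.
Qed.

Let lift_pi x : pres_lift f (pi x) = free_lift f x.
Proof.
apply/eqP; rewrite -subr_eq0; apply/eqP.
rewrite /pres_lift.
have -> : free_lift f (rep (pi x)) - free_lift f x
   = free_lift f ((-1) *: x + rep (pi x)).
  by rewrite free_lift_linear scaleN1r addrC.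
rewrite scaleN1r addrC.
by apply: lift0; apply/piP; rewrite repK.
Qed.

Lemma pres_lift_linear : linear (pres_lift f).
Proof.
move=> a x y; rewrite -[x]repK -[y]repK.
have -> : a *: pi (rep x) + pi (rep y) = pi (a *: rep x + rep y).
  by rewrite piD piZ.
by rewrite !lift_pi free_lift_linear.
Qed.

Lemma pres_lift_gen k : pres_lift f (gen k) = f k.
Proof. by rewrite lift_pi free_liftU. Qed.

End Lift.

Let pi0 : pi 0 = 0. Proof. by rewrite -(subrr 0) piB subrr. Qed.

Let malgZ1 c k : << c *g k >> = c *: << k >> :> {malg K[X]}.
Proof. by apply/malgP => k'; rewrite mcoeffZ !mcoeffU mulrnAr mulr1. Qed.

Let pi_sum x : pi x = \sum_(k <- msupp x) x@_k *: gen k.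
Proof.
rewrite {1}[x]monalgE (big_morph pi piD pi0).
by apply: eq_bigr => k _; rewrite malgZ1 piZ.
Qed.

Lemma gen_rel r : rel r -> free_lift gen r = 0.
Proof.
move=> rr; rewrite /free_lift -pi_sum -pi0.
by apply/piP; rewrite subr0; apply/asboolP => S _; apply.
Qed.

Lemma pres_lift_eq (W : lmodType K) (g : presented -> W) x :
  linear g -> g x = pres_lift (g \o gen) x.
Proof.
move=> glin.
pose g' : {linear presented -> W} := HB.pack g (GRing.isLinear.Build _ _ _ _ g glin).
rewrite -[LHS]/(g' x) -{1}[x]repK pi_sum raddf_sum.
by apply: eq_bigr => k _; rewrite -[LHS]/(g' _) linearZ_LR.
Qed.

End Presented.

Lemma free_lift_sub (K : fieldType) (X : choiceType) (Z : lmodType K)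
    (f : X -> Z) a x y z :
  free_lift f (<< x >> - a *: << y >> - << z >>) = f x - a *: f y - f z.
Proof.
have -> : << x >> - a *: << y >> - << z >>
  = (-1) *: << z >> + ((- a) *: << y >> + << x >>) :> {malg K[X]}.
  by rewrite scaleN1r scaleNr addrC [- _ + << x >>]addrC.
rewrite !free_lift_linear !free_liftU scaleN1r scaleNr.
by rewrite addrC [- _ + f x]addrC.
Qed.

(** * Tensor products of two spaces *)

Section Tensor.
Variables (K : fieldType) (V W : lmodType K).

Inductive tensor_rel : {malg K[(V * W)%type]} -> Prop :=
| TensorRelL a v v' w :
    tensor_rel (<< (a *: v + v', w) >> - a *: << (v, w) >> - << (v', w) >>)
| TensorRelR a v w w' :
    tensor_rel (<< (v, a *: w + w') >> - a *: << (v, w) >> - << (v, w') >>).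

Definition tensor : Type := presented tensor_rel.
HB.instance Definition _ := GRing.Lmodule.on tensor.

Definition tmul (v : V) (w : W) : tensor := gen tensor_rel (v, w).

Definition bilinear_map (Z : lmodType K) (f : V -> W -> Z) : Prop :=
  (forall w, linear (f^~ w)) /\ (forall v, linear (f v)).

Definition tensor_lift (Z : lmodType K) (f : V -> W -> Z) : tensor -> Z :=
  pres_lift (fun p => f p.1 p.2).

Lemma tmul_bilinear : bilinear_map tmul.
Proof.
split=> [w a x y|v a x y]; apply/eqP; rewrite -subr_eq0 opprD addrA; apply/eqP.
  rewrite -[LHS](free_lift_sub (gen tensor_rel) a (a *: x + y, w) (x, w) (y, w)).
  by apply: gen_rel; apply: TensorRelL.
rewrite -[LHS](free_lift_sub (gen tensor_rel) a (v, a *: x + y) (v, x) (v, y)).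
by apply: gen_rel; apply: TensorRelR.
Qed.

Section Lift.
Variables (Z : lmodType K) (f : V -> W -> Z).
Hypothesis f_bil : bilinear_map f.

Let f_rel r : tensor_rel r -> free_lift (fun p => f p.1 p.2) r = 0.
Proof.
case: f_bil => fl fr; case=> [a v v' w|a v w w']; rewrite free_lift_sub /=.
  by rewrite (fl w a v v') -addrA -opprD subrr.
by rewrite fr -addrA -opprD subrr.
Qed.

Lemma tensor_lift_linear : linear (tensor_lift f).
Proof. exact: pres_lift_linear f_rel. Qed.

Lemma tensor_lift_tmul v w : tensor_lift f (tmul v w) = f v w.
Proof. exact: (pres_lift_gen f_rel). Qed.

End Lift.

Lemma tensor_ext (Z : lmodType K) (g h : tensor -> Z) :
  linear g -> linear h -> (forall v w, g (tmul v w) = h (tmul v w)) -> g =1 h.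
Proof.
move=> gl hl gh x; rewrite (pres_lift_eq _ gl) (pres_lift_eq _ hl).
by rewrite /pres_lift /free_lift; apply: eq_bigr => -[v w] _; rewrite /= gh.
Qed.

End Tensor.

Arguments tensor {K} V%_type W%_type.
Arguments tensor_lift {K V W Z} f.
Notation "V ⊗ W" := (tensor V W)
  (at level 40, left associativity) : type_scope.
Notation "v ⊗ w" := (tmul v w)
  (at level 40, left associativity) : ring_scope.

Definition tensor_map (K : fieldType) (V W V' W' : lmodType K)
    (f : V -> V') (g : W -> W') : V ⊗ W -> V' ⊗ W' :=
  tensor_lift (fun v w => f v ⊗ g w).

(** [id ⊗ f ⊗ id] on [U ⊗ V ⊗ W ⊗ Z], with the factors bracketed in pairs. *)
Definition tensor_mid (K : fieldType) (U V W Z V' W' : lmodType K)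
    (f : V ⊗ W -> V' ⊗ W') : (U ⊗ V) ⊗ (W ⊗ Z) -> (U ⊗ V') ⊗ (W' ⊗ Z) :=
  tensor_lift (fun p q =>
    tensor_lift (fun (u : U) (v : V) =>
      tensor_lift (fun (w : W) (z : Z) =>
        tensor_lift (fun v' w' => (u ⊗ v') ⊗ (w' ⊗ z)) (f (v ⊗ w))) q) p).

(** * The space [T(V)]

[T(V)] is generated by the words [v_1 ... v_n], that is by the pure tensors
[v_1 ⊗ ... ⊗ v_n] of all lengths, subject to multilinearity in the letters.
The relations preserve the length, so this is the direct sum of the tensor
powers of [V], the [n]-th power being spanned by the words of length [n]; the
empty word is [1 \in K]. *)

Section TensorAlgebra.
Variables (K : fieldType) (V : lmodType K).

Inductive talg_rel : {malg K[seq V]} -> Prop :=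
| TalgRel s1 s2 a x y :
    talg_rel (<< s1 ++ (a *: x + y) :: s2 >>
              - a *: << s1 ++ x :: s2 >> - << s1 ++ y :: s2 >>).

Definition talg : Type := presented talg_rel.
HB.instance Definition _ := GRing.Lmodule.on talg.

Definition word (s : seq V) : talg := gen talg_rel s.

Definition multilinear (Z : lmodType K) (f : seq V -> Z) : Prop :=
  forall s1 s2 a x y,
    f (s1 ++ (a *: x + y) :: s2) = a *: f (s1 ++ x :: s2) + f (s1 ++ y :: s2).

Definition talg_lift (Z : lmodType K) (f : seq V -> Z) : talg -> Z :=
  pres_lift f.

Lemma word_multilinear : multilinear word.
Proof.
move=> s1 s2 a x y; apply/eqP; rewrite -subr_eq0 opprD addrA; apply/eqP.
rewrite -[LHS](free_lift_sub (gen talg_rel) a (s1 ++ (a *: x + y) :: s2)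
  (s1 ++ x :: s2) (s1 ++ y :: s2)).
by apply: gen_rel; apply: TalgRel.
Qed.

Section Lift.
Variables (Z : lmodType K) (f : seq V -> Z).
Hypothesis f_mul : multilinear f.

Let f_rel r : talg_rel r -> free_lift f r = 0.
Proof. by case=> *; rewrite free_lift_sub f_mul -addrA -opprD subrr. Qed.

Lemma talg_lift_linear : linear (talg_lift f).
Proof. exact: pres_lift_linear f_rel. Qed.

Lemma talg_lift_word s : talg_lift f (word s) = f s.
Proof. exact: (pres_lift_gen f_rel). Qed.

End Lift.

Lemma talg_ext (Z : lmodType K) (g h : talg -> Z) :
  linear g -> linear h -> (forall s, g (word s) = h (word s)) -> g =1 h.
Proof.
move=> gl hl gh x; rewrite (pres_lift_eq _ gl) (pres_lift_eq _ hl).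
by rewrite /pres_lift /free_lift; apply: eq_bigr => s _; rewrite /= gh.
Qed.

End TensorAlgebra.

Arguments talg_lift {K V Z} f.

Section TensorAlgebraMaps.
Variables (K : fieldType) (V : lmodType K).
Local Notation T := (talg V).

Definition talg_lift2 (Z : lmodType K) (f : seq V -> seq V -> Z) (x y : T) : Z :=
  talg_lift (fun u => talg_lift (fun v => f u v) y) x.

(** The tensor product inside [T(V)]. *)
Definition tcat : T -> T -> T := talg_lift2 (fun u v => word (u ++ v)).

Definition tin1 (a : V) : T := word [:: a].

(** The projection of [T(V)] onto its direct summand [V]. *)
Definition tpr1 : T -> V := talg_lift (fun s => if s is [:: a] then a else 0).

(** The inclusion of [V ⊗ V] in [T(V)]. *)
Definition tin2 : V ⊗ V -> T := tensor_lift (fun a b => word [:: a; b]).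

(** A map on [V ⊗ V], seen on words of length two. *)
Definition ton2 (f : V ⊗ V -> T) : T -> T :=
  talg_lift (fun s => if s is [:: a; b] then f (a ⊗ b) else 0).

(** [F ⊗ G] inside [T(V)], [F] acting on the first [n] letters of a word and
[G] on the remaining ones. *)
Definition tcut (n : nat) (F G : T -> T) : T -> T :=
  talg_lift (fun s => tcat (F (word (take n s))) (G (word (drop n s)))).

(** The identification of [V^{⊗ n + k}] with [V^{⊗ n} ⊗ V^{⊗ k}]. *)
Definition tsplit (n : nat) : T -> T ⊗ T :=
  talg_lift (fun s => word (take n s) ⊗ word (drop n s)).

Lemma talg_lift2_bilinear (Z : lmodType K) (f : seq V -> seq V -> Z) :
  (forall u, multilinear (f u)) -> (forall v, multilinear (f^~ v)) ->
  bilinear_map (talg_lift2 f).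
Proof.
move=> f1 f2.
have sum_lin (g h : T -> Z) a : linear g -> linear h ->
    linear (fun y => a *: g y + h y).
  move=> gl hl c y1 y2; rewrite gl hl !scalerDr !scalerA [a * c]mulrC -!addrA.
  by congr (_ + _); rewrite addrCA.
have m2 y : multilinear (fun u => talg_lift (f u) y).
  move=> s1 s2 a x z; move: y; apply: talg_ext.
  - exact: talg_lift_linear.
  - by apply: sum_lin; exact: talg_lift_linear.
  - by move=> s; rewrite !talg_lift_word //; exact: f2.
split=> [y|x]; first exact: talg_lift_linear (m2 y).
move=> a y z; move: x; apply: talg_ext.
- exact: talg_lift_linear.
- by apply: sum_lin; exact: talg_lift_linear.
- move=> s; rewrite /talg_lift2 !(talg_lift_word (m2 _)).
  exact: talg_lift_linear.
Qed.

Lemma multilinear_cat2 :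
  (forall u, multilinear (fun v : seq V => word (u ++ v)))
  /\ (forall v, multilinear (fun u : seq V => word (u ++ v))).
Proof.
split=> [u|v] s1 s2 a x y; first by rewrite !catA word_multilinear.
by rewrite -!catA !cat_cons word_multilinear.
Qed.

Lemma tcat_bilinear : bilinear_map tcat.
Proof. by case: multilinear_cat2 => *; exact: talg_lift2_bilinear. Qed.

Lemma tcat_word u v : tcat (word u) (word v) = word (u ++ v).
Proof.
have [m1 m2] := multilinear_cat2.
rewrite /tcat /talg_lift2 talg_lift_word ?talg_lift_word // => s1 s2 a x y.
by rewrite !talg_lift_word //; exact: m2.
Qed.

End TensorAlgebraMaps.

Arguments tin1 {K V}.
Arguments tpr1 {K V}.
Arguments tin2 {K V}.

(** * Reduced expressions in the symmetric groups *)

Lemma letter_ltS n (k : 'I_n.-1) : (k.+1 < n)%N.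
Proof. by rewrite -ltn_predRL. Qed.

Definition simple_transp n (k : 'I_n.-1) : 'S_n :=
  tperm (Ordinal (ltnW (letter_ltS k))) (Ordinal (letter_ltS k)).

(** The product [s_{i_1} ... s_{i_l}], the rightmost factor acting first; the
product of [{perm T}] composes in the opposite order. *)
Definition expr_perm n (l : seq 'I_n.-1) : 'S_n :=
  foldr (fun k w => (w * simple_transp k)%g) 1%g l.

Definition reduced_exprs n (w : 'S_n) : set (seq 'I_n.-1) :=
  [set l | expr_perm l = w /\
           forall l', expr_perm l' = w -> (size l <= size l')%N].

Definition chi_fun i j (k : 'I_(i + j)) : 'I_(i + j) :=
  cast_ord (addnC j i)
    match fintype.split k with
    | inl k1 => rshift j k1
    | inr k2 => lshift i k2
    end.

Lemma chi_inj i j : injective (@chi_fun i j).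
Proof.
move=> k k' /cast_ord_inj; case: (split_ordP k) => k1 ->;
  case: (split_ordP k') => k2 ->.
- by move=> /rshift_inj ->.
- by move=> /eqP; rewrite eq_rlshift.
- by move=> /eqP; rewrite eq_lrshift.
- by move=> /lshift_inj ->.
Qed.

Definition chi i j : 'S_(i + j) := perm (@chi_inj i j).

(** * Braidings *)

Section Braiding.
Variables (K : fieldType) (V : lmodType K) (sigma : V ⊗ V -> V ⊗ V).
Local Notation T := (talg V).

(** [sigma_{k+1}]: positions are counted from [0]. *)
Definition braid_at (k : nat) : T -> T :=
  tcut k id (tcut 2 (ton2 (tin2 \o sigma)) id).

Definition is_braiding : Prop :=
  [/\ linear sigma, bijective sigma &
      forall a b c : V, let x := word [:: a; b; c] in
        braid_at 0 (braid_at 1 (braid_at 0 x))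
        = braid_at 1 (braid_at 0 (braid_at 1 x))].

(** [T^sigma_w] on [V^{⊗ n}], computed on a chosen reduced expression; for a
braiding it does not depend on the choice. *)
Definition braid_perm n (w : 'S_n) : T -> T :=
  foldr (fun (k : 'I_n.-1) F => braid_at k \o F) id
        (xget [::] (reduced_exprs w)).

(** [beta_{ij}] as an endomorphism of [V^{⊗ i + j}]; for [i = 0] or [j = 0] the
permutation [chi i j] is trivial and this is the identity. *)
Definition beta_at (i j : nat) : T -> T := braid_perm (chi i j).

Definition beta : T ⊗ T -> T ⊗ T :=
  tensor_lift (talg_lift2 (fun u v =>
    tsplit (size v) (beta_at (size u) (size v) (word (u ++ v))))).

End Braiding.

(** * Algebras and the quantum quasi-shuffle product *)

Definition is_algebra (K : fieldType) (R : lmodType K) (mul : R -> R -> R) :=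
  bilinear_map mul /\ associative mul.

Section BraidedAlgebra.
Variables (K : fieldType) (A : lmodType K).
Local Notation T := (talg A).

Definition mul_on2 (m : A ⊗ A -> A) : T -> T := ton2 (tin1 \o m).
Definition braid_on2 (sigma : A ⊗ A -> A ⊗ A) : T -> T := ton2 (tin2 \o sigma).

Definition is_braided_algebra (m : A ⊗ A -> A) (sigma : A ⊗ A -> A ⊗ A) :=
  [/\ linear m, is_algebra (fun a b => m (a ⊗ b)), is_braiding sigma,
      (forall a b c : A, let x := word [:: a; b; c] in
         tcut 1 id (mul_on2 m) (braid_at sigma 0 (braid_at sigma 1 x))
         = braid_on2 sigma (tcut 2 (mul_on2 m) id x)) &
      (forall a b c : A, let x := word [:: a; b; c] in
         tcut 2 (mul_on2 m) id (braid_at sigma 1 (braid_at sigma 0 x))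
         = braid_on2 sigma (tcut 1 id (mul_on2 m) x))].

Definition is_unital_braided_algebra
    (m : A ⊗ A -> A) (oneA : A) (sigma : A ⊗ A -> A ⊗ A) :=
  [/\ is_braided_algebra m sigma,
      (forall a, m (oneA ⊗ a) = a),
      (forall a, m (a ⊗ oneA) = a),
      (forall a, sigma (a ⊗ oneA) = oneA ⊗ a) &
      (forall a, sigma (oneA ⊗ a) = a ⊗ oneA)].

Section QuasiShuffle.
Variables (m : A ⊗ A -> A) (sigma : A ⊗ A -> A ⊗ A).

(** The restriction of the product to [A^{⊗ i} ⊗ A^{⊗ j}], the latter being
identified with the span of the words of length [i + j]. *)
Fixpoint qshuffle_at (i : nat) : nat -> T -> T :=
  match i with
  | 0 => fun _ => id
  | i'.+1 => fix qshuffle_at_i (j : nat) : T -> T :=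
      match j with
      | 0 => id
      | j'.+1 => fun x =>
          tcut 1 id (qshuffle_at i' j'.+1) x
          + tcut 1 id (qshuffle_at_i j') (tcut i'.+2 (beta_at sigma i'.+1 1) id x)
          + tcut 2 (mul_on2 m) (qshuffle_at i' j')
              (tcut 1 id (tcut i'.+1 (beta_at sigma i' 1) id) x)
      end
  end.

Definition qshuffle : T ⊗ T -> T :=
  tensor_lift (talg_lift2 (fun u v =>
    qshuffle_at (size u) (size v) (word (u ++ v)))).

End QuasiShuffle.

(** The braiding of [T(A)] with [A], which takes values in [A ⊗ T(A)]. *)
Definition beta1 (sigma : A ⊗ A -> A ⊗ A) : T ⊗ A -> A ⊗ T :=
  tensor_map tpr1 id \o beta sigma \o tensor_map id tin1.

(** Only the quasi-shuffle factor involves [lambda *: m]. *)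
Definition diamond (m : A ⊗ A -> A) (sigma : A ⊗ A -> A ⊗ A) (lambda : K)
    (x y : A ⊗ T) : A ⊗ T :=
  tensor_map m (qshuffle (fun z => lambda *: m z) sigma)
    (tensor_mid (beta1 sigma) (x ⊗ y)).

Definition rb_operator (oneA : A) : A ⊗ T -> A ⊗ T :=
  tensor_lift (fun a u => oneA ⊗ tcat (tin1 a) u).

Lemma rb_operator_tmul oneA a u :
  rb_operator oneA (a ⊗ u) = oneA ⊗ tcat (tin1 a) u.
Proof.
rewrite /rb_operator tensor_lift_tmul //.
have [_ tr] := @tmul_bilinear K A T; have [cl cr] := @tcat_bilinear K A.
split=> [w b x y|v b x y]; last by rewrite cr tr.
have -> : tin1 (b *: x + y) = b *: tin1 x + tin1 y :> T.
  exact: (word_multilinear [::] [::]).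
by rewrite (cl w b (tin1 x) (tin1 y)) tr.
Qed.

(** The value of the operator when [u] is a scalar. *)
Lemma rb_operator_scalar oneA a nu :
  rb_operator oneA (a ⊗ (nu *: word [::])) = oneA ⊗ tin1 (nu *: a).
Proof.
have lin0 (U W : lmodType K) (f : U -> W) : linear f -> f 0 = 0.
  by move=> fl; have := fl (-1) 0 0; rewrite scaler0 addr0 scaleN1r addNr.
have [_ cr] := @tcat_bilinear K A.
rewrite rb_operator_tmul -[nu *: word _]addr0 cr tcat_word (lin0 _ _ _ (cr _)).
congr (_ ⊗ _); rewrite addr0 -[nu *: a]addr0 /tin1.
rewrite (word_multilinear [::] [::] nu a 0) /=.
have -> : word [:: (0 : A)] = 0.
  apply: (lin0 _ _ (fun b => word [:: b])) => b x y.
  exact: (word_multilinear [::] [::]).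
by rewrite addr0.
Qed.

End BraidedAlgebra.

Definition is_rota_baxter (K : fieldType) (lambda : K) (R : lmodType K)
    (mul : R -> R -> R) (P : R -> R) : Prop :=
  [/\ is_algebra mul, linear P &
      forall x y, mul (P x) (P y)
        = P (mul x (P y)) + P (mul (P x) y) + lambda *: P (mul x y)].

(* Main.v *)
(* Both products are computed by operators on T(A) acting on words. Write s F for
the operator that keeps the first letter of a word and applies F to the rest,
b for the braiding of the first two letters and M for their product. The
hypotheses on the braided algebra become relations between b, M, s b and s M in
a ring on which s is an endomorphism, and beta_{n,1} is
pull n = b (s b) ... (s^(n-1) b), because chi_{n,1} has exactly one reduced
expression. If Q i j n denotes the part of output length n of the quasi-shuffle
product of words of lengths i and j, then
  Q (i+1) (j+1) (n+1) = s (Q i (j+1) n) + s (Q (i+1) j n) (pull (i+1))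
                        + M (s s (Q i j n)) (s (pull i)),
and pull n (Q i j n) = s (Q i j n) (pull (i + j)), from which the associativity
of the quasi-shuffle product, and that of the diamond product, follow by
induction: seen in T(A), the diamond product is M (s s Q) (s pull).
The operator P puts 1_A in front of a word. Since the braiding moves 1_A freely,
P(x) times P(y) is 1_A in front of the quasi-shuffle product of x and y, and the
three terms of the recursion for the latter are the three terms of the
Rota-Baxter identity. *)
From HB Require Import structures.
From mathcomp Require Import all_boot all_order all_fingroup all_algebra.
From mathcomp Require Import finmap boolp classical_sets monalg.
Require Import Defs.
From mathcomp Require Import zify.

Set Implicit Arguments.
Unset Strict Implicit.
Unset Printing Implicit Defensive.

Import GRing.Theory.
Local Open Scope ring_scope.

(** * Quasi-shuffles in a ring with a shift *)

Section BraidedShifts.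
Variables (R : pzSemiRingType) (s : {rmorphism R -> R}) (b : R).

Lemma iter_shiftM k x y : iter k s (x * y) = iter k s x * iter k s y.
Proof. by elim: k => //= k ->; rewrite rmorphM. Qed.

Lemma iter_shiftD k x y : iter k s (x + y) = iter k s x + iter k s y.
Proof. by elim: k => //= k ->; rewrite rmorphD. Qed.

Lemma iter_shift0 k : iter k s 0 = 0.
Proof. by elim: k => //= k ->; rewrite rmorph0. Qed.

Lemma iter_shift1 k : iter k s 1 = 1.
Proof. by elim: k => //= k ->; rewrite rmorph1. Qed.

Lemma iter_shiftSr k x : iter k s (s x) = s (iter k s x).
Proof. by rewrite -iterSr. Qed.

(* [pull n] moves the letter at position [n] to the front. *)
Definition pull n : R := \prod_(k < n) iter k s b.

Lemma pullE n : pull n = \prod_(k < n) iter k s b. Proof. by []. Qed.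

Lemma pull0 : pull 0 = 1. Proof. exact: big_ord0. Qed.

Lemma pullS n : pull n.+1 = b * s (pull n).
Proof. by rewrite /pull big_ord_recl rmorph_prod. Qed.

Hypothesis b_shift2 : forall x, b * s (s x) = s (s x) * b.
Hypothesis b_braid : b * s b * b = s b * b * s b.

(** [pull n] involves only the first [n.+1] letters; [b_shift2] is the case of a single braiding. *)
Lemma pull_shift n x : pull n * iter n.+1 s x = iter n.+1 s x * pull n.
Proof.
elim: n => [|n IH] /=; first by rewrite pull0 mul1r mulr1.
by rewrite !pullS -mulrA -rmorphM IH rmorphM /= mulrA b_shift2 -mulrA.
Qed.

Lemma pullD i j : pull i * iter i s (pull j) = pull (i + j).
Proof.
elim: i => [|i IH] /=; first by rewrite pull0 mul1r.
by rewrite addSn !pullS -mulrA -rmorphM IH.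
Qed.

(** Moving a letter to the front shifts by one place the braiding of two letters that it passes. The
    braid relation enters when these are the first two letters; the other cases follow by
    shifting. *)
Lemma pull_generator n k :
  pull (k.+2 + n) * iter k s b = iter k.+1 s b * pull (k.+2 + n).
Proof.
elim: k => [|k IH].
  rewrite /= !addSn add0n !pullS rmorphM -!mulrA -b_shift2 !mulrA b_braid.
  by rewrite -mulrA.
by rewrite addSn pullS -mulrA -[iter k.+1 s b]/(s _) -rmorphM IH rmorphM /=
  !mulrA b_shift2.
Qed.

(** This is [pull_generator] for each factor of [pull k]. The index [c + k.+1 + n] places the outer
    letter behind all [k.+1] letters that the inner rotation rearranges. *)
Lemma pull_pull c n k :
  pull (c + k.+1 + n) * iter c s (pull k) = iter c.+1 s (pull k) * pull (c + k.+1 + n).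
Proof.
elim: k c => [|k IH] c; first by rewrite pull0 /= !iter_shift1 rmorph1 mul1r mulr1.
rewrite pullS iter_shiftM mulrA.
have -> : (c + k.+2 + n = c.+2 + (k + n))%N by lia.
rewrite pull_generator -mulrA iter_shiftSr -iterS.
have -> : (c.+2 + (k + n) = c.+1 + k.+1 + n)%N by lia.
by rewrite IH /= iter_shiftM rmorphM iter_shiftSr mulrA.
Qed.

(** * Rotations and the product of two letters *)

Section Multiplication.
Variable M : R.
Hypothesis M_shift2 : forall x, M * s (s x) = s x * M.
Hypothesis M_braid : M * s b * b = b * s M.
Hypothesis braid_M : s M * b * s b = b * M.

(** Moving a product of two adjacent letters to the front amounts to moving one, then the other, and
    multiplying there; [M_braid] handles one passed letter at a time. *)
Lemma pull_shift_mul n : pull n * iter n s M = M * s (pull n) * pull n.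
Proof.
elim: n => [|n IH] /=; first by rewrite pull0 rmorph1 mul1r !mulr1.
rewrite pullS -mulrA -rmorphM IH !rmorphM !mulrA -M_braid.
by rewrite -!mulrA; congr (_ * (_ * _)); rewrite !mulrA b_shift2.
Qed.

(** A letter that passes a product passes both of its factors. *)
Lemma pull_mul n : pull n.+1 * M = s M * pull n.+2.
Proof. by rewrite !pullS -mulrA -M_shift2 !rmorphM !mulrA braid_M. Qed.

End Multiplication.

(** * The quasi-shuffle product by output length *)

Section QuasiShuffle.
Variable M : R.
Hypothesis M_shift2 : forall x, M * s (s x) = s x * M.
Hypothesis M_braid : M * s b * b = b * s M.
Hypothesis braid_M : s M * b * s b = b * M.

(* The component of output length [n] of the quasi-shuffle of words of lengths
[i] and [j]; splitting by length makes it possible to rotate a letter past the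
result. *)
Fixpoint qsh i : nat -> nat -> R :=
  match i with
  | 0 => fun j n => (n == j)%:R
  | i'.+1 => fix qsh_i j n :=
      match j, n with
      | 0, _ => (n == i'.+1)%:R
      | _, 0 => 0
      | j'.+1, n'.+1 =>
          s (qsh i' j'.+1 n') + s (qsh_i j' n') * pull i'.+1
          + M * s (s (qsh i' j' n')) * s (pull i')
      end
  end.

Lemma qsh0l j n : qsh 0 j n = (n == j)%:R. Proof. by []. Qed.

Lemma qsh0r i n : qsh i 0 n = (n == i)%:R. Proof. by case: i. Qed.

Lemma qshSS0 i j : qsh i.+1 j.+1 0 = 0. Proof. by []. Qed.

Lemma qshSSS i j n : qsh i.+1 j.+1 n.+1 =
  s (qsh i j.+1 n) + s (qsh i.+1 j n) * pull i.+1
  + M * s (s (qsh i j n)) * s (pull i).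
Proof. by []. Qed.

(** No term of the recursion creates letters. Hence sums over [n < N] do not depend on [N] once it
    exceeds [i + j]. *)
Lemma qsh_eq0 i j n : (i + j < n)%N -> qsh i j n = 0.
Proof.
elim: n i j => // n IH [|i] [|j] lt_n; try by
  rewrite ?qsh0l ?qsh0r; case: eqP => // eq_n; lia.
rewrite qshSSS !IH ?rmorph0 ?(mulr0, mul0r) ?addr0 ?rmorph0 //; lia.
Qed.

(** A further letter can be moved to the front before or after multiplying. In the second and third
    terms of the recursion the rotations are exchanged by [pull_pull] with offsets 0 and 1, and the
    product is passed by [pull_mul]. *)
Lemma pull_qsh i j n : pull n * qsh i j n = s (qsh i j n) * pull (i + j).
Proof.
have qsh_delta k l : pull k * (k == l)%:R = s (k == l)%:R * pull l.
  by case: eqP => [->|_]; rewrite ?rmorph1 ?rmorph0 ?(mulr1, mul1r, mulr0, mul0r).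
elim: n i j => [|n IH] [|i] [|j]; rewrite ?qsh0l ?qsh0r ?addn0 ?qsh_delta //.
  by rewrite qshSS0 rmorph0 mulr0 mul0r.
have pull_shift_step x k l : pull k * x = s x * pull l ->
    pull k.+1 * s x = s (s x) * pull l.+1.
  by move=> pull_x; rewrite !pullS -mulrA -rmorphM pull_x rmorphM mulrA b_shift2 -mulrA.
have pull_past k : (k <= i + j.+1)%N ->
    pull (i.+1 + j.+1) * pull k = s (pull k) * pull (i.+1 + j.+1).
  move=> lt_k; have := @pull_pull 0 (i + j.+1 - k) k.
  by have -> : (0 + k.+1 + (i + j.+1 - k) = i.+1 + j.+1)%N by lia.
rewrite qshSSS !mulrDr !rmorphD !mulrDl; congr (_ + _ + _).
- by rewrite (pull_shift_step _ _ _ (IH _ _)).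
- rewrite rmorphM -mulrA -pull_past; last by lia.
  by rewrite !mulrA (pull_shift_step _ _ _ (IH _ _)) addnS.
rewrite !rmorphM -(mulrA _ _ (pull _)).
have -> : s (s (pull i)) * pull (i.+1 + j.+1) = pull (i.+1 + j.+1) * s (pull i).
  have := @pull_pull 1 j i; rewrite /=.
  by have -> : (1 + i.+1 + j = i.+1 + j.+1)%N by lia.
rewrite !mulrA; congr (_ * _).
rewrite (pull_mul M_shift2 braid_M) -!mulrA; congr (_ * _).
(* Two braidings are split off so that the induction hypothesis applies under two shifts. *)
have pull2 k : pull k.+2 = b * s b * s (s (pull k)) by rewrite !pullS rmorphM mulrA.
rewrite addSnnS !addnS !pull2 -mulrA -!rmorphM IH !rmorphM !mulrA.
by rewrite -(mulrA b) -rmorphM b_shift2 rmorphM !mulrA b_shift2 -!mulrA.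
Qed.

Lemma sum_delta_r N m (f : nat -> R) : (m < N)%N ->
  \sum_(n < N) f n * (n == m :> nat)%:R = f m.
Proof.
move=> lt_m; rewrite (bigD1 (Ordinal lt_m)) //= eqxx mulr1 big1 ?addr0 //.
by move=> n ne; rewrite (_ : (_ == _ :> nat) = false) ?mulr0 //; apply/negbTE.
Qed.

Lemma sum_delta_l N m (f : nat -> R) : (m < N)%N ->
  \sum_(n < N) (m == n :> nat)%:R * f n = f m.
Proof.
move=> lt_m; rewrite -[RHS](sum_delta_r f lt_m); apply: eq_bigr => n _.
by rewrite eq_sym; case: eqP => _; rewrite ?(mul0r, mulr0, mul1r, mulr1).
Qed.

Lemma iter_shift_delta i k n : iter i s (n == k :> nat)%:R = (n == k)%:R.
Proof. by case: eqP; rewrite ?iter_shift0 ?iter_shift1. Qed.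

(** The component of output length [p] of associativity for words of lengths [i], [j], [k]. The
    inner product has length [n], and [iter i s] makes it act behind the first word. *)
Definition qsh_assoc_at N i j k p :=
  \sum_(n < N) qsh n k p * qsh i j n
  = \sum_(n < N) qsh i n p * iter i s (qsh j k n).

Lemma qsh_assoc0l N j k p : (j + k < N)%N -> qsh_assoc_at N 0 j k p.
Proof.
move=> lt_N; rewrite /qsh_assoc_at (@sum_delta_r N j (fun n => qsh n k p)); last by lia.
have [lt_p|le_p] := ltnP p N; first by rewrite (@sum_delta_l N p (fun n => qsh j k n)).
(* For [p] not below [N] both sides vanish by length. *)
rewrite qsh_eq0; last by lia.
rewrite big1 // => n _; rewrite qsh0l (_ : (p == n :> nat) = false) ?mul0r //.
by apply/negbTE/eqP => eq_p; have := ltn_ord n; lia.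
Qed.

Lemma qsh_assoc0m N i k p : (i + k < N)%N -> qsh_assoc_at N i 0 k p.
Proof.
move=> lt_N; rewrite /qsh_assoc_at.
under eq_bigr => n _ do rewrite qsh0r.
rewrite (@sum_delta_r N i (fun n => qsh n k p)); last by lia.
under eq_bigr => n _ do rewrite qsh0l iter_shift_delta.
by rewrite (@sum_delta_r N k (fun n => qsh i n p)) //; lia.
Qed.

Lemma qsh_assoc0r N i j p : (i + j < N)%N -> qsh_assoc_at N i j 0 p.
Proof.
move=> lt_N; rewrite /qsh_assoc_at.
under [RHS]eq_bigr => n _ do rewrite qsh0r iter_shift_delta.
rewrite (@sum_delta_r N j (fun n => qsh i n p)); last by lia.
under eq_bigr => n _ do rewrite qsh0r.
have [lt_p|le_p] := ltnP p N; first by rewrite (@sum_delta_l N p (fun n => qsh i j n)).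
rewrite qsh_eq0; last by lia.
rewrite big1 // => n _; rewrite (_ : (p == n :> nat) = false) ?mul0r //.
by apply/negbTE/eqP => eq_p; have := ltn_ord n; lia.
Qed.

(** * Associativity of the term that multiplies the first letters of all three words *)

Section AssociativityStep.
Variable M' : R.
Hypothesis M'_shift2 : forall x, M' * s (s x) = s x * M'.
Hypothesis M'_braid : M' * s b * b = b * s M'.
Hypothesis M'_assoc : M' * M' = M' * s M'.

Lemma pull_shift_mul_step i j x :
  pull i * iter i s (M' * s (s x) * s (pull j))
  = M' * s (s (iter i s x)) * s (pull (i + j)) * pull i.
Proof.
have past y : pull i * s (iter i s y) = s (iter i s y) * pull i.
  exact: pull_shift.
rewrite !iter_shiftM !mulrA (pull_shift_mul M'_braid) !iter_shiftSr.
rewrite -(mulrA _ (pull i)) -[in s (s (iter i s x))]iter_shiftSr past iter_shiftSr.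
rewrite mulrA -(mulrA M') -rmorphM past rmorphM -!mulrA.
by rewrite past (mulrA (s (pull i))) -rmorphM pullD.
Qed.

(** [M'] is kept apart from the [M] of the recursion because the argument serves twice: with [M]
    itself for the quasi-shuffle product, and with the unscaled product for the diamond product. *)
Lemma mul_qsh_assoc N i j k p : qsh_assoc_at N i j k p ->
  \sum_(n < N) M' * s (s (qsh n k p)) * s (pull n)
                * (M' * s (s (qsh i j n)) * s (pull i))
  = \sum_(n < N) M' * s (s (qsh i n p)) * s (pull i)
                * iter i.+1 s (M' * s (s (qsh j k n)) * s (pull j)).
Proof.
move=> IH.
(* The common value: the first letters of the second and third words are brought forward in turn,
   the tails are multiplied, then the three letters. *)
transitivity (M' * s M' * s (s (s (\sum_(n < N) qsh n k p * qsh i j n)))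
              * s (s (pull (i + j))) * s (pull i)).
  rewrite !rmorph_sum mulr_sumr !mulr_suml; apply: eq_bigr => n _.
  rewrite !mulrA -(mulrA _ _ M') -M'_shift2 !mulrA.
  rewrite -(mulrA M' _ M') -M'_shift2 !mulrA M'_assoc.
  rewrite -(mulrA _ (s (s (pull n))) (s (s (qsh i j n)))).
  by rewrite -(rmorphM s (s _)) -(rmorphM s (pull n)) pull_qsh !rmorphM !mulrA.
rewrite {}IH !rmorph_sum mulr_sumr !mulr_suml; apply: eq_bigr => n _.
rewrite iterS -[RHS]mulrA -rmorphM pull_shift_mul_step !rmorphM !mulrA.
by rewrite -(mulrA M' _ (s M')) -rmorphM -M'_shift2 rmorphM !mulrA.
Qed.

End AssociativityStep.

Hypothesis M_assoc : M * M = M * s M.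

Lemma shift_mul_qsh x i j n :
  s x * qsh i.+1 j.+1 n.+1 =
    s (x * qsh i j.+1 n) + s (x * qsh i.+1 j n) * pull i.+1
    + M * s (s (x * qsh i j n)) * s (pull i).
Proof. by rewrite qshSSS !mulrDr !rmorphM !mulrA M_shift2. Qed.

(** For words [u], [v], [w], the seven terms correspond to the choices of words whose first letters
    make up the first letter of the result, in the order [u], [v], [uv], [w], [uw], [vw], [uvw]. *)
Lemma qsh_mul_l i j k n p :
  qsh n.+1 k.+1 p.+1 * qsh i.+1 j.+1 n.+1 =
    s (qsh n k.+1 p * qsh i j.+1 n)
    + s (qsh n k.+1 p * qsh i.+1 j n) * pull i.+1
    + M * s (s (qsh n k.+1 p * qsh i j n)) * s (pull i)
    + s (qsh n.+1 k p * qsh i.+1 j.+1 n.+1) * pull (i.+1 + j.+1)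
    + M * s (s (qsh n k p * qsh i j.+1 n)) * s (pull (i + j.+1))
    + M * s (s (qsh n k p * qsh i.+1 j n)) * s (pull (i + j.+1)) * pull i.+1
    + M * s (s (qsh n k p)) * s (pull n) * (M * s (s (qsh i j n)) * s (pull i)).
Proof.
rewrite (qshSSS n k p) 2!mulrDl shift_mul_qsh -!addrA; do 3 congr (_ + _).
rewrite -(mulrA _ (pull n.+1)) pull_qsh mulrA -rmorphM; congr (_ + _).
rewrite (qshSSS i j n) !mulrDr -!addrA; congr (_ + (_ + _)).
  by rewrite -mulrA -(rmorphM s (pull n)) pull_qsh !rmorphM !mulrA.
rewrite mulrA -(mulrA _ (s (pull n))) -(rmorphM s (pull n)) pull_qsh !rmorphM !mulrA.
by rewrite addSnnS.
Qed.

(** Unfolds an inner product that stands behind [l] letters and whose first letter is then moved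
    past them. The third term is left as it is, since its treatment depends on what multiplies
    it. *)
Lemma shift_pull_qsh x l j k n :
  s x * pull l * iter l s (qsh j.+1 k.+1 n.+1) =
    s (x * iter l s (qsh j k.+1 n)) * pull l
    + s (x * iter l s (qsh j.+1 k n)) * pull (l + j.+1)
    + s x * pull l * iter l s (M * s (s (qsh j k n)) * s (pull j)).
Proof.
have past y : pull l * iter l s (s y) = s (iter l s y) * pull l.
  by rewrite iter_shiftSr; exact: pull_shift.
rewrite (qshSSS j k n) !iter_shiftD 2!mulrDr; congr (_ + _ + _).
  by rewrite -mulrA past mulrA rmorphM.
by rewrite iter_shiftM -mulrA (mulrA (pull l)) past -(mulrA _ (pull l)) pullD
  mulrA rmorphM.
Qed.

(** The same seven cases in the same order as in [qsh_mul_l]. The inner product keeps its length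
    [n.+1] in the first term here, but in the fourth term there. *)
Lemma qsh_mul_r i j k n p :
  qsh i.+1 n.+1 p.+1 * iter i.+1 s (qsh j.+1 k.+1 n.+1) =
    s (qsh i n.+1 p * iter i s (qsh j.+1 k.+1 n.+1))
    + s (qsh i.+1 n p * iter i.+1 s (qsh j k.+1 n)) * pull i.+1
    + M * s (s (qsh i n p * iter i s (qsh j k.+1 n))) * s (pull i)
    + s (qsh i.+1 n p * iter i.+1 s (qsh j.+1 k n)) * pull (i.+1 + j.+1)
    + M * s (s (qsh i n p * iter i s (qsh j.+1 k n))) * s (pull (i + j.+1))
    + M * s (s (qsh i.+1 n p * iter i.+1 s (qsh j k n))) * s (pull (i + j.+1))
        * pull i.+1
    + M * s (s (qsh i n p)) * s (pull i)
        * iter i.+1 s (M * s (s (qsh j k n)) * s (pull j)).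
Proof.
rewrite (qshSSS i n p) 2!mulrDl [iter i.+1 s (qsh j.+1 k.+1 n.+1)]iterS -rmorphM.
rewrite -!addrA; congr (_ + _).
rewrite -iterS shift_pull_qsh -(mulrA (s _) (pull i.+1) (iter _ _ (M * _ * _))).
rewrite pull_shift_mul_step // addSnnS !mulrA -M_shift2.
rewrite -(mulrA M (s (s _)) (s (s _))) -(rmorphM s (s _)) -(rmorphM s (qsh i.+1 n p)).
have -> : M * s (s (qsh i n p)) * s (pull i) * iter i.+1 s (qsh j.+1 k.+1 n.+1) =
    M * s (s (qsh i n p * iter i s (qsh j k.+1 n))) * s (pull i)
    + M * s (s (qsh i n p * iter i s (qsh j.+1 k n))) * s (pull (i + j.+1))
    + M * s (s (qsh i n p)) * s (pull i)
        * iter i.+1 s (M * s (s (qsh j k n)) * s (pull j)).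
  rewrite !iterS -!(mulrA M) -!(rmorphM s) shift_pull_qsh !rmorphD !mulrDr.
  by rewrite !(rmorphM s (s _) (pull _)) !mulrA.
rewrite addSnnS -!addrA; congr (_ + _); rewrite [RHS]addrCA; congr (_ + _).
by rewrite addrCA; congr (_ + _); rewrite addrCA.
Qed.

(** Reindexes the terms in which the inner product keeps its length. *)
Lemma sum_shift N (f : nat -> R) : f 0 = 0 -> f N = 0 ->
  \sum_(n < N) f n.+1 = \sum_(n < N) f n.
Proof.
move=> f0 fN.
(* The first term is split off one copy of the sum and the last term off the other, as a semiring
   has no subtraction. *)
have : \sum_(n < N.+1) f n = \sum_(n < N.+1) f n by [].
by rewrite {1}big_ord_recl big_ord_recr /= fN addr0 f0 add0r.
Qed.

(** Induction on a bound for the total length: each of the seven terms involves words of smaller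
    total length. *)
Lemma qsh_assoc N i j k p : (i + j + k < N)%N -> qsh_assoc_at N i j k p.
Proof.
elim: N i j k p => // N IH [|i] [|j] [|k] p lt_N.
1,2,3,4 : by apply: qsh_assoc0l; lia.
1,2 : by apply: qsh_assoc0m; lia.
  by apply: qsh_assoc0r; lia.
(* The inner products are of nonempty words, so the summand of inner length 0 vanishes on both
   sides. *)
rewrite /qsh_assoc_at !big_ord_recl !qshSS0 iter_shift0 !mulr0 !add0r.
case: p => [|p].
  by rewrite !big1 // => n _; rewrite qshSS0 mul0r.
under eq_bigr => n _ do rewrite qsh_mul_l.
under [RHS]eq_bigr => n _ do rewrite qsh_mul_r.
rewrite !big_split /= (mul_qsh_assoc M_shift2 M_braid M_assoc); last by apply: IH; lia.
rewrite -!mulr_suml -!mulr_sumr -!rmorph_sum.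
rewrite (IH i j.+1 k.+1); last by lia.
rewrite (IH i.+1 j k.+1); last by lia.
rewrite (IH i j k.+1); last by lia.
rewrite (IH i j.+1 k); last by lia.
rewrite (IH i.+1 j k); last by lia.
(* What remains to reindex is the fourth term on the left and the first on the right, where the
   inner length is [n.+1]. *)
rewrite (@sum_shift N (fun n => qsh n k p * qsh i.+1 j.+1 n)); first last.
- by rewrite (@qsh_eq0 _ _ N) ?mulr0 //; lia.
- by rewrite qshSS0 mulr0.
rewrite (IH i.+1 j.+1 k); last by lia.
rewrite (@sum_shift N (fun n => qsh i n p * iter i s (qsh j.+1 k.+1 n))) //.
- by rewrite qshSS0 iter_shift0 mulr0.
- by rewrite (@qsh_eq0 _ _ N) ?iter_shift0 ?mulr0 //; lia.
Qed.

End QuasiShuffle.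
End BraidedShifts.

(** * Operators on words *)

Section LinearMaps.
Variable K : fieldType.
Implicit Types U V W : lmodType K.

Lemma lin0 U V (f : U -> V) : linear f -> f 0 = 0.
Proof. by move=> fl; have := fl (-1) 0 0; rewrite scaler0 addr0 scaleN1r addNr. Qed.

Lemma linZ U V (f : U -> V) a x : linear f -> f (a *: x) = a *: f x.
Proof. by move=> fl; rewrite -[a *: x]addr0 fl lin0 // addr0. Qed.

Lemma linD U V (f : U -> V) x y : linear f -> f (x + y) = f x + f y.
Proof. by move=> fl; rewrite -[x]scale1r fl !scale1r. Qed.

Lemma lin_sum U V (f : U -> V) (I : Type) (r : seq I) (P : pred I) (F : I -> U) :
  linear f -> f (\sum_(i <- r | P i) F i) = \sum_(i <- r | P i) f (F i).
Proof. by move=> fl; apply: (big_morph f) => [x y|]; rewrite ?linD ?lin0. Qed.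

Lemma lin_id U : linear (@id U). Proof. by []. Qed.

Lemma lin_comp U V W (f : V -> W) (g : U -> V) :
  linear f -> linear g -> linear (fun x => f (g x)).
Proof. by move=> fl gl a x y; rewrite gl fl. Qed.

Lemma lin_add U V (f g : U -> V) :
  linear f -> linear g -> linear (fun x => f x + g x).
Proof. by move=> fl gl a x y; rewrite fl gl scalerDr addrACA. Qed.

Lemma lin_scale U V (f : U -> V) c : linear f -> linear (fun x => c *: f x).
Proof. by move=> fl a x y; rewrite fl scalerDr !scalerA mulrC. Qed.

Lemma lin_zero U V : linear (fun _ : U => 0 : V).
Proof. by move=> a x y; rewrite scaler0 addr0. Qed.

End LinearMaps.

Section Words.
Variables (K : fieldType) (A : lmodType K).
Local Notation T := (talg A).

Lemma lin_tcatl (x : T) : linear (tcat x).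
Proof. by case: (@tcat_bilinear K A) => _; apply. Qed.

Lemma lin_tcatr (y : T) : linear (fun x => tcat x y).
Proof. by case: (@tcat_bilinear K A) => + _; apply. Qed.

Lemma tcat0 (x : T) : tcat x 0 = 0. Proof. exact/lin0/lin_tcatl. Qed.

Lemma tcat_nil_l (x : T) : tcat (word [::]) x = x.
Proof.
move: x; apply: talg_ext; [exact: lin_tcatl | by [] |].
by move=> s; rewrite tcat_word.
Qed.

Lemma tcat_nil_r (x : T) : tcat x (word [::]) = x.
Proof.
move: x; apply: talg_ext; [exact: lin_tcatr | by [] |].
by move=> s; rewrite tcat_word cats0.
Qed.

Lemma tcatA (x y z : T) : tcat x (tcat y z) = tcat (tcat x y) z.
Proof.
move: x; apply: talg_ext => [||u].
- exact: lin_tcatr.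
- by apply: (lin_comp (f := fun t => tcat t z)); exact: lin_tcatr.
move: y; apply: talg_ext => [||v].
- by apply: (lin_comp (f := tcat _)); [exact: lin_tcatl|exact: lin_tcatr].
- by apply: (lin_comp (f := fun t => tcat t z)); [exact: lin_tcatr|exact: lin_tcatl].
move: z; apply: talg_ext => [||w].
- by apply: (lin_comp (f := tcat _)); exact: lin_tcatl.
- exact: lin_tcatl.
by rewrite !tcat_word catA.
Qed.

Lemma lin_tin1 : linear (@tin1 K A).
Proof. by move=> a x y; exact: (word_multilinear [::] [::]). Qed.

Section Cut.
Variables (n : nat) (F G : T -> T).
Hypotheses (Fl : linear F) (Gl : linear G).

Let tcut_multilinear : multilinear (fun s : seq A =>
  tcat (F (word (take n s))) (G (word (drop n s)))).
Proof.
move=> s1 s2 a x y; rewrite !take_cat !drop_cat; case: ltnP => _.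
  by rewrite word_multilinear Gl lin_tcatl.
case: (n - size s1)%N => [|k]; last by rewrite word_multilinear Fl lin_tcatr.
by rewrite !take0 !drop0 (word_multilinear [::]) Gl lin_tcatl.
Qed.

Lemma lin_tcut : linear (tcut n F G).
Proof. exact: talg_lift_linear tcut_multilinear. Qed.

Lemma tcut_wordE s :
  tcut n F G (word s) = tcat (F (word (take n s))) (G (word (drop n s))).
Proof. exact: talg_lift_word tcut_multilinear _. Qed.

End Cut.

Section OnTwo.
Variable f : A ⊗ A -> T.
Hypothesis fl : linear f.

Let ton2_multilinear :
  multilinear (fun s : seq A => if s is [:: a; b] then f (a ⊗ b) else 0).
Proof.
have [tl tr] := @tmul_bilinear K A A.
move=> [|x1 [|x2 s1]] [|y1 [|y2 s2]] a x y //=; rewrite ?scaler0 ?addr0 //.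
- by rewrite -fl -tl.
- by rewrite -fl -tr.
- by case: s1 => [|? ?] /=; rewrite scaler0 addr0.
- by case: s1 => [|? ?] /=; rewrite scaler0 addr0.
- by case: s1 => [|? ?] /=; rewrite scaler0 addr0.
Qed.

Lemma lin_ton2 : linear (ton2 f).
Proof. exact: talg_lift_linear ton2_multilinear. Qed.

Lemma ton2_wordE s :
  ton2 f (word s) = if s is [:: a; b] then f (a ⊗ b) else 0.
Proof. exact: talg_lift_word ton2_multilinear _. Qed.

End OnTwo.

Let tin2_bilinear : bilinear_map (fun a b : A => word [:: a; b]).
Proof.
by split=> [w a x y|v a x y]; [exact: (word_multilinear [::] [:: w]) |
  exact: (word_multilinear [:: v] [::])].
Qed.

Lemma lin_tin2 : linear (@tin2 K A).
Proof. exact: tensor_lift_linear tin2_bilinear. Qed.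

Lemma tin2_tmul a b : tin2 (a ⊗ b) = word [:: a; b] :> T.
Proof. exact: tensor_lift_tmul tin2_bilinear _ _. Qed.

(** * Homogeneous tensors *)

Definition tproj (n : nat) : T -> T :=
  talg_lift (fun s => if size s == n then word s else 0).

Let tproj_multilinear n :
  multilinear (fun s : seq A => if size s == n then word s else 0).
Proof.
move=> s1 s2 a x y; rewrite !size_cat /= ; case: eqP => _.
  exact: word_multilinear.
by rewrite scaler0 addr0.
Qed.

Lemma lin_tproj n : linear (tproj n).
Proof. exact: talg_lift_linear (tproj_multilinear n). Qed.

Lemma tproj_word n s : tproj n (word s) = if size s == n then word s else 0.
Proof. exact: talg_lift_word (tproj_multilinear n) _. Qed.

Definition homog (n : nat) (x : T) : Prop := tproj n x = x.

Lemma homog_word n s : size s = n -> homog n (word s).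
Proof. by rewrite /homog tproj_word => ->; rewrite eqxx. Qed.

Lemma homog0 n : homog n 0. Proof. exact/lin0/lin_tproj. Qed.

Lemma homogD n x y : homog n x -> homog n y -> homog n (x + y).
Proof. by rewrite /homog => hx hy; rewrite linD ?hx ?hy //; exact: lin_tproj. Qed.

Lemma homogZ n a x : homog n x -> homog n (a *: x).
Proof. by rewrite /homog => hx; rewrite linZ ?hx //; exact: lin_tproj. Qed.

(** Composed with the projection, the two maps can be compared on all words. *)
Lemma homog_ext (Z : lmodType K) (g h : T -> Z) n x :
  linear g -> linear h ->
  (forall s, size s = n -> g (word s) = h (word s)) -> homog n x -> g x = h x.
Proof.
move=> gl hl gh <-; move: x; apply: talg_ext => [||s].
- by apply: (lin_comp gl); exact: lin_tproj.
- by apply: (lin_comp hl); exact: lin_tproj.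
by rewrite tproj_word; case: eqP => [/gh //|_]; rewrite !lin0.
Qed.

Lemma homog_map (F : T -> T) n k x : linear F ->
  (forall s, size s = n -> homog k (F (word s))) -> homog n x -> homog k (F x).
Proof.
move=> Fl Fs; apply: (@homog_ext _ (fun x => tproj k (F x)) F) => //.
by apply: (lin_comp _ Fl); exact: lin_tproj.
Qed.

Lemma homog_tcat n k x y : homog n x -> homog k y -> homog (n + k) (tcat x y).
Proof.
move=> hx hy.
apply: (@homog_map (fun x => tcat x y) n _ x (lin_tcatr _) _ hx) => s sn.
apply: (@homog_map (tcat (word s)) k _ y (lin_tcatl _) _ hy) => t tk.
by rewrite tcat_word; apply: homog_word; rewrite size_cat sn tk.
Qed.

Lemma homog_tin1 a : homog 1 (tin1 a). Proof. exact: homog_word. Qed.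

Lemma homog_tin2 z : homog 2 (tin2 z).
Proof.
move: z; apply: (@tensor_ext _ _ _ _ (fun z => tproj 2 (tin2 z)) tin2) => [||a b].
- by apply: (lin_comp _ lin_tin2); exact: lin_tproj.
- exact: lin_tin2.
by rewrite tin2_tmul; exact: homog_word.
Qed.

(* Fixing the line of the empty word is what makes [shift] below additive,
multiplicative and unital. *)
Record wordop := Wordop {
  wordop_fun :> T -> T;
  wordop_linear : linear wordop_fun;
  wordop_nil : exists c, wordop_fun (word [::]) = c *: word [::] }.

HB.instance Definition _ := gen_eqMixin wordop.
HB.instance Definition _ := gen_choiceMixin wordop.

Lemma wordop_ext (F G : wordop) : (forall s, F (word s) = G (word s)) -> F = G.
Proof.
move=> FG; have {FG} : wordop_fun F = G.
  by apply: funext; apply: talg_ext FG; exact: wordop_linear.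
case: F G => [f fl fn] [g gl gn] /= fg; subst g.
by rewrite (Prop_irrelevance fl gl) (Prop_irrelevance fn gn).
Qed.

Let zero_nil : exists c, (0 : T) = c *: word [::].
Proof. by exists 0; rewrite scale0r. Qed.

Let one_nil : exists c, id (word [::] : T) = c *: word [::].
Proof. by exists 1; rewrite scale1r. Qed.

Let add_nil (F G : wordop) :
  exists c, F (word [::]) + G (word [::]) = c *: word [::].
Proof.
have [[c ->] [d ->]] := (wordop_nil F, wordop_nil G).
by exists (c + d); rewrite scalerDl.
Qed.

Let mul_nil (F G : wordop) : exists c, F (G (word [::])) = c *: word [::].
Proof.
have [[c Fc] [d ->]] := (wordop_nil F, wordop_nil G).
by exists (d * c); rewrite linZ ?Fc ?scalerA //; exact: wordop_linear.
Qed.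

(** * The semiring of operators, with composition as product *)

Definition wordop0 := Wordop (@lin_zero K T T) zero_nil.
Definition wordop1 := Wordop (@lin_id K T) one_nil.
Definition wordop_add (F G : wordop) :=
  Wordop (lin_add (wordop_linear F) (wordop_linear G)) (add_nil F G).
Definition wordop_mul (F G : wordop) :=
  Wordop (lin_comp (wordop_linear F) (wordop_linear G)) (mul_nil F G).

Let addA : associative wordop_add.
Proof. by move=> F G H; apply: wordop_ext => s /=; rewrite addrA. Qed.
Let addC : commutative wordop_add.
Proof. by move=> F G; apply: wordop_ext => s /=; rewrite addrC. Qed.
Let add0 : left_id wordop0 wordop_add.
Proof. by move=> F; apply: wordop_ext => s /=; rewrite add0r. Qed.
HB.instance Definition _ := GRing.isNmodule.Build wordop addA addC add0.

Let mulA : associative wordop_mul.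
Proof. by move=> F G H; apply: wordop_ext. Qed.
Let mul1 : left_id wordop1 wordop_mul.
Proof. by move=> F; apply: wordop_ext. Qed.
Let mulx1 : right_id wordop1 wordop_mul.
Proof. by move=> F; apply: wordop_ext. Qed.
Let mulDl : left_distributive wordop_mul +%R.
Proof. by move=> F G H; apply: wordop_ext. Qed.
Let mulDr : right_distributive wordop_mul +%R.
Proof.
by move=> F G H; apply: wordop_ext => s /=; rewrite linD //; exact: wordop_linear.
Qed.
Let mul0 : left_zero 0 wordop_mul.
Proof. by move=> F; apply: wordop_ext. Qed.
Let mulx0 : right_zero 0 wordop_mul.
Proof.
by move=> F; apply: wordop_ext => s /=; rewrite lin0 //; exact: wordop_linear.
Qed.
HB.instance Definition _ := GRing.Nmodule_isPzSemiRing.Build wordop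
  mulA mul1 mulx1 mulDl mulDr mul0 mulx0.

Lemma wordop_addE (F G : wordop) x : (F + G) x = F x + G x. Proof. by []. Qed.
Lemma wordop_mulE (F G : wordop) x : (F * G) x = F (G x). Proof. by []. Qed.
Lemma wordop_0E x : (0 : wordop) x = 0. Proof. by []. Qed.
Lemma wordop_1E x : (1 : wordop) x = x. Proof. by []. Qed.

Lemma wordop_sumE (I : Type) (r : seq I) (F : I -> wordop) x :
  (\sum_(i <- r) F i) x = \sum_(i <- r) F i x.
Proof. by apply: (big_morph (fun G : wordop => G x)). Qed.

(** * The shift as an endomorphism of this semiring *)

Lemma shift_nil (F : wordop) :
  exists c, tcut 1 id F (word [::]) = c *: word [::].
Proof.
have [c Fc] := wordop_nil F; exists c.
by rewrite (tcut_wordE 1 (@lin_id _ _) (wordop_linear F)) /= tcat_nil_l.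
Qed.

Definition shift (F : wordop) : wordop :=
  Wordop (lin_tcut 1 (@lin_id _ _) (wordop_linear F)) (shift_nil F).

Arguments shift : simpl never.

Lemma shift_wordE (F : wordop) s :
  shift F (word s) = tcat (word (take 1 s)) (F (word (drop 1 s))).
Proof. by rewrite /= tcut_wordE //; exact: wordop_linear. Qed.

Lemma shift_word0 (F : wordop) : shift F (word [::]) = F (word [::]).
Proof. by rewrite shift_wordE tcat_nil_l. Qed.

Lemma shift_tcat1 (F : wordop) a x :
  shift F (tcat (word [:: a]) x) = tcat (word [:: a]) (F x).
Proof.
move: x; apply: talg_ext => [||s].
- by apply: (lin_comp (wordop_linear _)); exact: lin_tcatl.
- by apply: (lin_comp _ (wordop_linear _)); exact: lin_tcatl.
by rewrite tcat_word shift_wordE /= take0 drop0.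
Qed.

Lemma shift_cons (F : wordop) a s :
  shift F (word (a :: s)) = tcat (word [:: a]) (F (word s)).
Proof. by rewrite -shift_tcat1 tcat_word. Qed.

Let shiftD : {morph shift : F G / F + G}.
Proof.
move=> F G; apply: wordop_ext => -[|a s]; rewrite wordop_addE.
  by rewrite !shift_word0.
by rewrite !shift_cons wordop_addE linD //; exact: lin_tcatl.
Qed.
Let shift0 : shift 0 = 0.
Proof.
by apply: wordop_ext => s; rewrite shift_wordE wordop_0E tcat0.
Qed.
Let shift1 : shift 1 = 1.
Proof.
by apply: wordop_ext => s; rewrite shift_wordE !wordop_1E tcat_word cat_take_drop.
Qed.
Let shiftM : {morph shift : F G / F * G}.
Proof.
move=> F G; apply: wordop_ext => -[|a s]; rewrite wordop_mulE.
  rewrite !shift_word0; have [c Gc] := wordop_nil G.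
  by rewrite wordop_mulE Gc !linZ ?shift_word0 //; exact: wordop_linear.
by rewrite !shift_cons shift_tcat1.
Qed.
HB.instance Definition _ := GRing.isNmodMorphism.Build _ _ shift (shift0, shiftD).
HB.instance Definition _ := GRing.isMonoidMorphism.Build _ _ shift (shift1, shiftM).

Lemma iter_shiftE k (F : wordop) : iter k shift F =1 tcut k id F.
Proof.
move=> x; move: x; apply: talg_ext => [||s].
- exact: wordop_linear.
- by apply: lin_tcut => //; exact: wordop_linear.
rewrite tcut_wordE //; last exact: wordop_linear.
elim: k s => [|k IH] s; first by rewrite take0 drop0 tcat_nil_l.
case: s => [|a s]; first by rewrite shift_word0 IH.
by rewrite shift_cons IH /= -[a :: take k s]cat1s -tcat_word tcatA.
Qed.

Lemma iter_shift_tcat k (F : wordop) x y : homog k x ->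
  iter k shift F (tcat x y) = tcat x (F y).
Proof.
apply: (@homog_ext _ (fun x => iter k shift F (tcat x y)) (fun x => tcat x (F y))).
- by apply: (lin_comp (wordop_linear _)); exact: lin_tcatr.
- exact: lin_tcatr.
move=> s <-; move: y; apply: talg_ext => [||t].
- by apply: (lin_comp (wordop_linear _)); exact: lin_tcatl.
- by apply: (lin_comp _ (wordop_linear _)); exact: lin_tcatl.
rewrite tcat_word iter_shiftE (tcut_wordE _ (@lin_id _ _) (wordop_linear F)).
by rewrite (take_size_cat _ (erefl _)) (drop_size_cat _ (erefl _)).
Qed.

(* [F] acts on the first [n] letters, turns them into [k] letters, and leaves
the rest of the word alone. *)
Definition prefix_op (n k : nat) (F : wordop) : Prop :=
  forall x y, homog n x -> homog k (F x) /\ F (tcat x y) = tcat (F x) y.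

Lemma prefix_opP n k (F : wordop) :
  (forall s, size s = n -> homog k (F (word s))) ->
  (forall s t, size s = n -> F (word (s ++ t)) = tcat (F (word s)) (word t)) ->
  prefix_op n k F.
Proof.
move=> Fk Fcat x y hx; split; first exact: (homog_map (wordop_linear F) Fk).
move: hx; apply: (@homog_ext _ (fun x => F (tcat x y)) (fun x => tcat (F x) y)).
- by apply: (lin_comp (wordop_linear _)); exact: lin_tcatr.
- by apply: (lin_comp (g := F) _ (wordop_linear _)); exact: lin_tcatr.
move=> s sn; move: y; apply: talg_ext => [||t].
- by apply: (lin_comp (wordop_linear _)); exact: lin_tcatl.
- exact: lin_tcatl.
by rewrite tcat_word Fcat.
Qed.

Lemma prefix_op_mul n k l F G :
  prefix_op k l F -> prefix_op n k G -> prefix_op n l (F * G).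
Proof.
move=> Fp Gp x y hx; have [hG Gx] := Gp x y hx; have [hF Fx] := Fp _ y hG.
by rewrite !wordop_mulE Gx Fx.
Qed.

Lemma prefix_op_add n k F G :
  prefix_op n k F -> prefix_op n k G -> prefix_op n k (F + G).
Proof.
move=> Fp Gp x y hx; have [hG Gx] := Gp x y hx; have [hF Fx] := Fp x y hx.
rewrite !wordop_addE Gx Fx; split; first exact: homogD.
by rewrite [RHS](linD _ _ (lin_tcatr y)).
Qed.

Lemma prefix_op0 n k : prefix_op n k 0.
Proof.
move=> x y _; rewrite !wordop_0E; split; first exact: homog0.
by rewrite (lin0 (lin_tcatr y)).
Qed.

Lemma prefix_op1 n : prefix_op n n 1. Proof. by []. Qed.

Lemma size_eqS (X : Type) n (s : seq X) :
  size s = n.+1 -> exists a u, s = a :: u /\ size u = n.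
Proof. by case: s => // a u [un]; exists a, u. Qed.

Lemma prefix_op_shift n k F : prefix_op n k F -> prefix_op n.+1 k.+1 (shift F).
Proof.
move=> Fp; apply: prefix_opP => [s|s t] /size_eqS[a [u [-> un]]].
  rewrite shift_cons -add1n; apply: homog_tcat; first exact: homog_word.
  by have [] := Fp _ 0 (homog_word un).
rewrite cat_cons !shift_cons -tcat_word -tcatA; congr (tcat _ _).
by have [_] := Fp _ (word t) (homog_word un).
Qed.

Lemma prefix_op_widen i n k F :
  prefix_op n k F -> prefix_op (n + i) (k + i) F.
Proof.
move=> Fp; apply: prefix_opP => [s sn|s t sn].
  rewrite -(cat_take_drop n s) -tcat_word.
  have szt : size (take n s) = n by rewrite size_takel // sn leq_addr.
  have [hF ->] := Fp _ (word (drop n s)) (homog_word szt).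
  by apply: homog_tcat => //; apply: homog_word; rewrite size_drop sn addKn.
rewrite -(cat_take_drop n s) -catA -!tcat_word.
have szt : size (take n s) = n by rewrite size_takel // sn leq_addr.
have [_ ->] := Fp _ (tcat (word (drop n s)) (word t)) (homog_word szt).
have [_ ->] := Fp _ (word (drop n s)) (homog_word szt).
exact: tcatA.
Qed.

(** [prefix_op] says nothing about words shorter than [n], so these are part of the comparison. *)
Lemma prefix_op_eq n k F G : prefix_op n k F -> prefix_op n k G ->
  (forall s, (size s <= n)%N -> F (word s) = G (word s)) -> F = G.
Proof.
move=> Fp Gp FG; apply: wordop_ext => s.
have [le_s|lt_s] := leqP (size s) n; first exact: FG.
have sn : size (take n s) = n by rewrite size_take lt_s.
rewrite -(cat_take_drop n s) -tcat_word.
have [_ ->] := Fp _ (word (drop n s)) (homog_word sn).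
have [_ ->] := Gp _ (word (drop n s)) (homog_word sn).
by rewrite FG ?sn.
Qed.

(** * Operators given by a map on the first two letters *)

Section PairOperators.
Variable f : A ⊗ A -> T.
Hypothesis fl : linear f.

Let pair_op_nil : exists c, tcut 2 (ton2 f) id (word [::]) = c *: word [::].
Proof.
exists 0; rewrite (tcut_wordE 2 (lin_ton2 fl) (@lin_id _ _)) /= ton2_wordE //.
by rewrite (lin0 (lin_tcatr _)) scale0r.
Qed.

Definition pair_op : wordop :=
  Wordop (lin_tcut 2 (lin_ton2 fl) (@lin_id _ _)) pair_op_nil.

Lemma pair_op_word s : pair_op (word s) =
  if s is a :: b :: t then tcat (f (a ⊗ b)) (word t) else 0.
Proof.
rewrite /= (tcut_wordE 2 (lin_ton2 fl) (@lin_id _ _)) ton2_wordE //.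
case: s => [|a [|b s]]; [exact: lin0 (lin_tcatr _)|exact: lin0 (lin_tcatr _)|].
by rewrite /= take0 drop0.
Qed.

Lemma pair_op_tcat a b x :
  pair_op (tcat (word [:: a; b]) x) = tcat (f (a ⊗ b)) x.
Proof.
move: x; apply: talg_ext => [||s].
- by apply: (lin_comp (wordop_linear _)); exact: lin_tcatl.
- exact: lin_tcatl.
by rewrite tcat_word pair_op_word.
Qed.

Lemma pair_op_homog2 x : homog 2 x -> pair_op x = ton2 f x.
Proof.
apply: homog_ext; [exact: wordop_linear | exact: lin_ton2 |].
move=> [|a [|b [|c s]]] // _.
by rewrite pair_op_word ton2_wordE // tcat_nil_r.
Qed.

Variable k : nat.
Hypothesis fk : forall z, homog k (f z).

Lemma prefix_op_pair : prefix_op 2 k pair_op.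
Proof.
apply: prefix_opP => [s|s t] /size_eqS[a [u [-> /size_eqS[b [v [-> /size0nil ->]]]]]].
  by rewrite pair_op_word tcat_nil_r.
by rewrite !pair_op_word tcat_nil_r.
Qed.

(** The letters behind the first two are left alone and end up behind the [k] letters that replace
    those two. On words of fewer than two letters both sides are 0. *)
Lemma pair_op_shift2 F : pair_op * shift (shift F) = iter k shift F * pair_op.
Proof.
apply: wordop_ext => -[|a [|b s]]; rewrite !wordop_mulE.
- rewrite !shift_word0 pair_op_word (lin0 (wordop_linear _)).
  have [c ->] := wordop_nil F.
  by rewrite linZ ?pair_op_word ?scaler0 //; exact: wordop_linear.
- rewrite shift_cons shift_word0 pair_op_word (lin0 (wordop_linear _)).
  have [c ->] := wordop_nil F.
  rewrite (linZ _ _ (lin_tcatl _)) tcat_nil_r.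
  by rewrite linZ ?pair_op_word ?scaler0 //; exact: wordop_linear.
rewrite !shift_cons pair_op_word (iter_shift_tcat _ _ (fk _)) tcatA tcat_word.
exact: pair_op_tcat.
Qed.

End PairOperators.

(** * Scalars as central operators *)

Let scalar_nil c : exists d, c *: (word [::] : T) = d *: word [::].
Proof. by exists c. Qed.

Definition scalar_op (c : K) : wordop :=
  Wordop (lin_scale c (@lin_id K T)) (scalar_nil c).

Lemma scalar_opE c x : scalar_op c x = c *: x. Proof. by []. Qed.

Lemma scalar_op_comm c F : scalar_op c * F = F * scalar_op c.
Proof.
by apply: wordop_ext => s; rewrite !wordop_mulE !scalar_opE linZ //;
  exact: wordop_linear.
Qed.

Lemma shift_scalar_op c : shift (scalar_op c) = scalar_op c.
Proof.
apply: wordop_ext => s; rewrite shift_wordE !scalar_opE (linZ _ _ (lin_tcatl _)).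
by rewrite tcat_word cat_take_drop.
Qed.

End Words.

(** * The reduced expression of chi_{i,1} *)

Section ReducedExpressions.

Lemma simple_transpE n (k : 'I_n.-1) (x : 'I_n) :
  simple_transp k x = (if x == k :> nat then k.+1
                       else if x == k.+1 :> nat then nat_of_ord k else x) :> nat.
Proof.
rewrite /simple_transp; case: tpermP => [->|->|/eqP + /eqP] /=.
- by rewrite eqxx.
- by rewrite eqxx; case: eqP => // /eqP; rewrite -{2}[nat_of_ord k]addn0 -addn1 eqn_add2l.
by rewrite -!val_eqE /= => /negbTE-> /negbTE->.
Qed.

Lemma expr_perm_cons n (k : 'I_n.-1) l x :
  expr_perm (k :: l) x = simple_transp k (expr_perm l x).
Proof. by rewrite /= permM. Qed.

(** A simple transposition lowers a value by at most one. *)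
Lemma expr_perm_lower n (l : seq 'I_n.-1) (x : 'I_n) :
  (x <= expr_perm l x + size l)%N.
Proof.
elim: l => [|k l IH]; first by rewrite /= perm1 addn0.
rewrite expr_perm_cons simple_transpE /=; do 2?case: eqP; lia.
Qed.

(** If the bound is attained, every factor lowers the value by one, and the value it acts on
    determines the factor. *)
Lemma expr_perm_tight n (l : seq 'I_n.-1) (x : 'I_n) :
  x = (expr_perm l x + size l)%N :> nat ->
  map val l = iota (expr_perm l x) (size l).
Proof.
elim: l => [//|k l IH]; have := expr_perm_lower l x.
rewrite expr_perm_cons simple_transpE /=.
case: eqP => [->|_]; first by move=> le_x x_eq; exfalso; lia.
case: eqP => [y_eq|_]; last by move=> le_x x_eq; exfalso; lia.
by move=> _ x_eq; rewrite IH ?y_eq //; lia.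
Qed.

Lemma expr_perm_iota n (l : seq 'I_n.-1) a c (x : 'I_n) :
  map val l = iota a c ->
  expr_perm l x = (if (a <= x < a + c)%N then x.+1
                   else if x == (a + c)%N :> nat then a else x) :> nat.
Proof.
elim: l a c => [|k l IH] a [|c] //=.
  by move=> _; rewrite perm1 addn0; do 2?case: ifP => //; lia.
case=> k_eq l_eq; rewrite permM simple_transpE (IH _ _ l_eq) k_eq.
by do !case: ifP; lia.
Qed.

Lemma chi1E i (x : 'I_(i + 1)) : chi i 1 x = (if (x < i)%N then x.+1 else 0%N) :> nat.
Proof.
rewrite /chi permE /chi_fun; by case: splitP => y /= => [->|_]; rewrite ?ord1.
Qed.

Lemma expr_perm_enum i : expr_perm (enum 'I_(i + 1).-1) = chi i 1.
Proof.
apply/permP => y; apply: val_inj; rewrite /= chi1E.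
rewrite (@expr_perm_iota _ _ 0 i y); last by rewrite val_enum_ord addn1.
by have := ltn_ord y; do !case: ifP; lia.
Qed.

(** The last point goes to 0, which takes at least [i] factors. *)
Lemma chi1_lower i l : expr_perm l = chi i 1 -> (i <= size l)%N.
Proof.
move=> lE; have := @expr_perm_lower _ l (rshift i ord0).
by rewrite lE chi1E /= addn0 ltnn.
Qed.

Lemma size_enum_chi1 i : size (enum 'I_(i + 1).-1) = i.
Proof. by rewrite size_enum_ord addn1. Qed.

Lemma reduced_chi1_enum i : reduced_exprs (chi i 1) (enum 'I_(i + 1).-1).
Proof.
split=> [|l /chi1_lower]; first exact: expr_perm_enum.
by rewrite size_enum_chi1.
Qed.

(** A reduced expression attains the bound of [expr_perm_lower] at the last point, so it is unique.
    This makes the choice in [braid_perm] computable. *)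
Lemma reduced_chi1 i l : reduced_exprs (chi i 1) l -> map val l = iota 0 i.
Proof.
case=> lE /(_ _ (expr_perm_enum i)) le_l.
have sl : size l = i.
  by apply/eqP; rewrite eqn_leq (chi1_lower lE) andbT; rewrite size_enum_chi1 in le_l.
have := @expr_perm_tight _ l (rshift i ord0).
by rewrite lE chi1E /= addn0 ltnn sl; exact.
Qed.

End ReducedExpressions.

(** * The braiding and the product as operators *)

Section VanishingOperators.
Variables (K : fieldType) (A : lmodType K).
Implicit Types F G : wordop A.

(** The axioms of a braided algebra concern exactly three letters; for an equality of operators,
    shorter words must be dealt with as well. *)
Definition kills n F := forall s, (size s < n)%N -> F (word s) = 0.

Lemma kills_shift n F : kills n.+1 F -> kills n.+2 (shift F).
Proof.
move=> F0 [|a s] ss; first by rewrite shift_word0 F0.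
by rewrite shift_cons F0 ?tcat0.
Qed.

Lemma kills_mulr n F G : kills n G -> kills n (F * G).
Proof.
by move=> G0 s ss; rewrite wordop_mulE G0 // (lin0 (wordop_linear _)).
Qed.

(** Words of length [n] have images of length [k], which [F] kills. *)
Lemma kills_mul n k F G :
  kills n G -> prefix_op n k G -> kills k.+1 F -> kills n.+1 (F * G).
Proof.
move=> G0 Gp F0 s; rewrite ltnS leq_eqVlt => /orP[/eqP sn|ss]; last first.
  by rewrite wordop_mulE G0 // (lin0 (wordop_linear _)).
have [+ _] := Gp _ 0 (homog_word sn).
move=> /(@homog_ext _ _ _ F (fun=> 0)) H; rewrite wordop_mulE H //.
- exact: wordop_linear.
- exact: lin_zero.
- by move=> u su; rewrite F0 ?su.
Qed.

Lemma kills_eq n k F G :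
  prefix_op n k F -> prefix_op n k G -> kills n F -> kills n G ->
  (forall s, size s = n -> F (word s) = G (word s)) -> F = G.
Proof.
move=> Fp Gp F0 G0 FG; apply: (prefix_op_eq Fp Gp) => s.
by rewrite leq_eqVlt => /orP[/eqP/FG//|ss]; rewrite F0 // G0.
Qed.

Section Pair.
Variables (f : A ⊗ A -> talg A) (fl : linear f).

Lemma kills_pair : kills 2 (pair_op fl).
Proof. by move=> [|a [|b s]] // _; rewrite pair_op_word. Qed.

(** [ton2] vanishes except on two letters, whereas [pair_op] accepts longer words; hence the
    restriction to length three. *)
Lemma shift_pair_homog3 x :
  homog 3 x -> shift (pair_op fl) x = tcut 1 id (ton2 f) x.
Proof.
apply: homog_ext; [exact: wordop_linear | exact: lin_tcut (lin_ton2 fl) |].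
move=> s /size_eqS[a [u [-> /size_eqS[b [v [-> /size_eqS[c [w [-> /size0nil ->]]]]]]]]].
rewrite shift_cons (tcut_wordE 1 (@lin_id _ _) (lin_ton2 fl)).
have h2 : homog 2 (word [:: b; c]) by exact: homog_word.
by rewrite [take _ _]/= [drop _ _]/= (pair_op_homog2 fl h2).
Qed.

End Pair.

End VanishingOperators.

(** * The braiding, its product relations, and the rotations as [beta_{i,1}] *)

Section BraidingOperators.
Variables (K : fieldType) (A : lmodType K) (sigma : A ⊗ A -> A ⊗ A).
Hypothesis sigma_lin : linear sigma.
Local Notation T := (talg A).

Definition braid_op : wordop A := pair_op (lin_comp (@lin_tin2 K A) sigma_lin).

Lemma braid_atE k : braid_at sigma k =1 iter k (@shift K A) braid_op.
Proof. by move=> x; rewrite iter_shiftE. Qed.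

Local Notation pull := (pull (@shift K A) braid_op).

(** Every reduced expression lists the generators in the order of the factors of [pull i]. *)
Lemma beta_atE i x : beta_at sigma i 1 x = pull i x.
Proof.
rewrite /beta_at /braid_perm.
have /reduced_chi1 lE : reduced_exprs (chi i 1) (xget [::] (reduced_exprs (chi i 1))).
  exact: xgetPex (ex_intro _ _ (reduced_chi1_enum i)).
rewrite pullE -(big_mkord xpredT (fun k => iter k (@shift K A) braid_op)).
rewrite /index_iota subn0 -lE; elim: (xget _ _) => [|k l IH] /=.
  by rewrite big_nil.
by rewrite big_cons wordop_mulE -IH braid_atE.
Qed.

Lemma prefix_op_braid : prefix_op 2 2 braid_op.
Proof. by apply: prefix_op_pair => z; exact: homog_tin2. Qed.

Lemma braid_op_shift2 F :
  braid_op * shift (shift F) = shift (shift F) * braid_op.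
Proof. by apply: (@pair_op_shift2 _ _ _ _ 2) => z; exact: homog_tin2. Qed.

Lemma prefix_op_pull i : prefix_op i.+1 i.+1 (pull i).
Proof.
elim: i => [|i IH]; first by rewrite pull0; exact: prefix_op1.
rewrite pullS; apply: prefix_op_mul (prefix_op_shift IH).
exact: (prefix_op_widen (i := i) prefix_op_braid).
Qed.

Lemma kills_braid : kills 2 braid_op. Proof. exact: kills_pair. Qed.

Lemma prefix_op_braid3 : prefix_op 3 3 braid_op.
Proof. exact: (prefix_op_widen (i := 1) prefix_op_braid). Qed.

Lemma prefix_op_shift_braid : prefix_op 3 3 (shift braid_op).
Proof. exact: prefix_op_shift prefix_op_braid. Qed.

Lemma kills_shift_braid : kills 3 (shift braid_op).
Proof. exact: kills_shift kills_braid. Qed.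

Lemma braid_op_braid : is_braiding sigma ->
  braid_op * shift braid_op * braid_op
  = shift braid_op * braid_op * shift braid_op.
Proof.
move=> [_ _ braid].
have [bp sbp] := (prefix_op_braid3, prefix_op_shift_braid).
apply: (@kills_eq _ _ 3 3).
- exact: prefix_op_mul (prefix_op_mul bp sbp) bp.
- exact: prefix_op_mul (prefix_op_mul sbp bp) sbp.
- apply: (kills_mul kills_braid prefix_op_braid).
  exact: kills_mulr kills_shift_braid.
- exact: kills_mulr kills_shift_braid.
move=> s /size_eqS[a [u [-> /size_eqS[b [v [-> /size_eqS[c [w [-> /size0nil ->]]]]]]]]].
by have := braid a b c; rewrite /= !braid_atE.
Qed.

(** * The product of two letters and its relations with the braiding *)

Section Multiplication.
Variable m : A ⊗ A -> A.
Hypothesis m_lin : linear m.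

Definition mul_op : wordop A := pair_op (lin_comp (@lin_tin1 K A) m_lin).

Lemma prefix_op_mul_op : prefix_op 2 1 mul_op.
Proof. by apply: prefix_op_pair => z; exact: homog_tin1. Qed.

Lemma mul_op_shift2 F : mul_op * shift (shift F) = shift F * mul_op.
Proof. by apply: (@pair_op_shift2 _ _ _ _ 1) => z; exact: homog_tin1. Qed.

Lemma kills_mul_op : kills 2 mul_op. Proof. exact: kills_pair. Qed.

Lemma mul_op_cons a b s : mul_op (word (a :: b :: s)) = word (m (a ⊗ b) :: s).
Proof. by rewrite /mul_op pair_op_word -cat1s -tcat_word. Qed.

Let Mp : prefix_op 3 2 mul_op.
Proof. exact: (prefix_op_widen (i := 1) prefix_op_mul_op). Qed.

Let sMp : prefix_op 3 2 (shift mul_op).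
Proof. exact: prefix_op_shift prefix_op_mul_op. Qed.

Let sM0 : kills 3 (shift mul_op).
Proof. exact: kills_shift kills_mul_op. Qed.

Hypothesis braided : is_braided_algebra m sigma.

Lemma mul_op_braid : mul_op * shift braid_op * braid_op = braid_op * shift mul_op.
Proof.
have [_ _ _ _ mb] := braided.
have [bp sbp] := (prefix_op_braid3, prefix_op_shift_braid).
apply: (@kills_eq _ _ 3 2).
- exact: prefix_op_mul (prefix_op_mul Mp sbp) bp.
- exact: prefix_op_mul prefix_op_braid sMp.
- apply: (kills_mul kills_braid prefix_op_braid).
  exact: kills_mulr kills_shift_braid.
- exact: kills_mulr sM0.
move=> s /[dup] /homog_word hs.
move=> /size_eqS[a [u [-> /size_eqS[b [v [-> /size_eqS[c [w [-> /size0nil ->]]]]]]]]].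
have h3 : homog 3 (word [:: a; b; c]) by exact: homog_word.
move: (mb a b c); cbv zeta; rewrite !braid_atE [iter 1 _ _]/= [iter 0 _ _]/=.
(* [tcut 2 (mul_on2 m) id] is convertible to [mul_op]; the product behind the first letter has to be
   identified on three letters. *)
rewrite -(shift_pair_homog3 (lin_comp (@lin_tin1 K A) m_lin) h3) => E; apply: (etrans E).
have [h2 _] := sMp 0 h3.
by rewrite [RHS]wordop_mulE (pair_op_homog2 _ h2).
Qed.

Lemma braid_mul_op : shift mul_op * braid_op * shift braid_op = braid_op * mul_op.
Proof.
have [_ _ _ mb _] := braided.
have [bp sbp] := (prefix_op_braid3, prefix_op_shift_braid).
apply: (@kills_eq _ _ 3 2).
- exact: prefix_op_mul (prefix_op_mul sMp bp) sbp.
- exact: prefix_op_mul prefix_op_braid Mp.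
- exact: kills_mulr kills_shift_braid.
- exact: (kills_mul kills_mul_op prefix_op_mul_op kills_braid).
move=> s.
move=> /size_eqS[a [u [-> /size_eqS[b [v [-> /size_eqS[c [w [-> /size0nil ->]]]]]]]]].
have h3 : homog 3 (word [:: a; b; c]) by exact: homog_word.
move: (mb a b c); cbv zeta; rewrite !braid_atE [iter 1 _ _]/= [iter 0 _ _]/=.
have [h3' _] := prefix_op_mul bp sbp 0 h3.
rewrite -(shift_pair_homog3 (lin_comp (@lin_tin1 K A) m_lin) h3') => E; apply: (etrans E).
have [h2 _] := Mp 0 h3.
by rewrite [RHS]wordop_mulE (pair_op_homog2 _ h2).
Qed.

Lemma mul_op_assoc : mul_op * mul_op = mul_op * shift mul_op.
Proof.
have [_ [_ mA] _ _ _] := braided.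
apply: (@kills_eq _ _ 3 1).
- exact: prefix_op_mul prefix_op_mul_op Mp.
- exact: prefix_op_mul prefix_op_mul_op sMp.
- exact: (kills_mul kills_mul_op prefix_op_mul_op kills_mul_op).
- exact: kills_mulr sM0.
move=> s.
move=> /size_eqS[a [u [-> /size_eqS[b [v [-> /size_eqS[c [w [-> /size0nil ->]]]]]]]]].
by rewrite !wordop_mulE shift_cons !mul_op_cons tcat_word mul_op_cons mA.
Qed.

End Multiplication.

End BraidingOperators.

Arguments prefix_op_pull {K A sigma} sigma_lin i [x] y _.

(** * The quantum quasi-shuffle product *)

Section QuasiShuffleOperators.
Variables (K : fieldType) (A : lmodType K) (sigma : A ⊗ A -> A ⊗ A).
Variables (m : A ⊗ A -> A) (lambda : K).
Hypotheses (sigma_lin : linear sigma) (m_lin : linear m).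
Local Notation T := (talg A).
Local Notation b := (braid_op sigma_lin).
Local Notation M' := (mul_op m_lin).
Local Notation s := (@shift K A).
Local Notation pull := (pull s b).

(** [lambda] enters as a central operator fixed by the shift, so the relations for [m] carry
    over. *)
Definition smul_op : wordop A := scalar_op A lambda * M'.
Local Notation M := smul_op.

Lemma smul_op_shift2 F : M * s (s F) = s F * M.
Proof.
by rewrite /smul_op -mulrA mul_op_shift2 !mulrA -scalar_op_comm.
Qed.

Lemma smul_op_braid : is_braided_algebra m sigma -> M * s b * b = b * s M.
Proof.
move=> H; rewrite rmorphM /= shift_scalar_op mulrA -scalar_op_comm -!mulrA.
by rewrite (mulrA M') (mul_op_braid _ _ H).
Qed.

Lemma braid_smul_op : is_braided_algebra m sigma -> s M * b * s b = b * M.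
Proof.
move=> H; rewrite rmorphM /= shift_scalar_op /smul_op mulrA -scalar_op_comm -!mulrA.
by rewrite (mulrA (s _)) (braid_mul_op _ _ H).
Qed.

Lemma smul_op_assoc : is_braided_algebra m sigma -> M * M = M * s M.
Proof.
move=> H; rewrite rmorphM /= shift_scalar_op /smul_op -!mulrA; congr (_ * _).
by rewrite !mulrA -scalar_op_comm -!mulrA (mul_op_assoc _ H).
Qed.

Local Notation Q := (qsh s b M).

Lemma prefix_op_qsh i j n : prefix_op (i + j) n (Q i j n).
Proof.
have delta k l : prefix_op k l (l == k)%:R.
  by case: eqP => [->|_]; [exact: prefix_op1 | exact: prefix_op0].
elim: n i j => [|n IH] [|i] [|j]; rewrite ?addn0; try exact: delta.
rewrite qshSSS; apply: prefix_op_add; first apply: prefix_op_add.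
- exact: prefix_op_shift (IH _ _).
- rewrite addnS; apply: prefix_op_mul (prefix_op_shift (IH _ _)) _.
exact: (prefix_op_widen (i := j) (prefix_op_pull sigma_lin i.+1)).
apply: (@prefix_op_mul _ _ _ (i + j).+2).
  apply: (@prefix_op_mul _ _ _ n.+2).
    apply: (@prefix_op_mul _ _ _ n.+1); first by move=> x y hx; split;
      [exact: homogZ | rewrite !scalar_opE; exact: esym (linZ _ _ (lin_tcatr _))].
    exact: (prefix_op_widen (i := n) (prefix_op_mul_op _)).
  exact: prefix_op_shift (prefix_op_shift (IH _ _)).
rewrite addnS; apply: (prefix_op_widen (i := j) (n := i.+2) (k := i.+2)).
exact: prefix_op_shift (prefix_op_pull _ i).
Qed.

(** * Cuts as shifts on homogeneous tensors *)

Section TcutOperators.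
Variables (G : T -> T) (F : wordop A) (k : nat).
Hypotheses (Gl : linear G) (GF : forall x, homog k x -> G x = F x).

Lemma tcut1_shift x : homog k.+1 x -> tcut 1 id G x = s F x.
Proof.
apply: homog_ext; [exact: lin_tcut | exact: wordop_linear |].
move=> t /size_eqS[a [u [-> uk]]].
rewrite shift_cons (tcut_wordE 1 (@lin_id _ _) Gl) /= take0 drop0.
by rewrite (GF (homog_word uk)).
Qed.

Lemma tcut2_smul x : homog k.+2 x ->
  tcut 2 (mul_on2 (fun z => lambda *: m z)) G x = M (s (s F) x).
Proof.
have ml : linear (fun z => tin1 (lambda *: m z) : T).
  by apply: (lin_comp (@lin_tin1 K A)); exact: lin_scale.
apply: (@homog_ext _ _ _ _ (fun x => M (s (s F) x))); [exact: lin_tcut (lin_ton2 ml) Gl |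
  exact: lin_comp (wordop_linear _) (wordop_linear _) |].
move=> t /size_eqS[a [u [-> /size_eqS[c [v [-> vk]]]]]].
rewrite (tcut_wordE 2 (lin_ton2 ml) Gl) !shift_cons.
rewrite [take _ _]/= [drop _ _]/= take0 drop0 (ton2_wordE ml) (GF (homog_word vk)).
rewrite wordop_mulE scalar_opE tcatA tcat_word pair_op_tcat.
by rewrite (linZ _ _ (@lin_tin1 K A)) (linZ _ _ (lin_tcatr _)).
Qed.

End TcutOperators.

Lemma lin_beta_at i : linear (beta_at sigma i 1).
Proof. by move=> a x y; rewrite !beta_atE wordop_linear. Qed.

(** [pull i] leaves the letters after the first [i.+1] alone, so cutting them off changes
    nothing. *)
Lemma tcut_beta i k x : homog (i.+1 + k) x ->
  tcut i.+1 (beta_at sigma i 1) id x = pull i x.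
Proof.
apply: homog_ext; [exact: lin_tcut (lin_beta_at i) (@lin_id _ _) |
  exact: wordop_linear |].
move=> t tk; rewrite (tcut_wordE _ (lin_beta_at i) (@lin_id _ _)) beta_atE.
have st : size (take i.+1 t) = i.+1 by rewrite size_takel // tk leq_addr.
have [_ <-] := prefix_op_pull sigma_lin i (word (drop i.+1 t)) (homog_word st).
by rewrite tcat_word cat_take_drop.
Qed.

Local Notation qsh_at := (qshuffle_at (fun z => lambda *: m z) sigma).

Lemma qshuffle_atSS i j x : qsh_at i.+1 j.+1 x =
  tcut 1 id (qsh_at i j.+1) x
  + tcut 1 id (qsh_at i.+1 j) (tcut i.+2 (beta_at sigma i.+1 1) id x)
  + tcut 2 (mul_on2 (fun z => lambda *: m z)) (qsh_at i j)
      (tcut 1 id (tcut i.+1 (beta_at sigma i 1) id) x).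
Proof. by []. Qed.

Lemma lin_qshuffle_at i j : linear (qsh_at i j).
Proof.
elim: i j => [|i IHi] j; first exact: lin_id.
have ml : linear (fun z => tin1 (lambda *: m z) : T).
  by apply: (lin_comp (@lin_tin1 K A)); exact: lin_scale.
elim: j => [|j IHj]; first exact: lin_id.
have bl k : linear (tcut k.+1 (beta_at sigma k 1) id).
  exact: lin_tcut (lin_beta_at k) (@lin_id _ _).
apply: (lin_add (lin_add _ _)).
- exact: lin_tcut.
- by apply: lin_comp; [exact: lin_tcut | exact: bl].
- apply: lin_comp; first exact: lin_tcut (lin_ton2 ml) (IHi j).
  exact: lin_tcut (@lin_id _ _) (bl i).
Qed.

Lemma sum_qshSSS i j N :
  \sum_(n < N.+1) Q i.+1 j.+1 n =
    s (\sum_(n < N) Q i j.+1 n) + s (\sum_(n < N) Q i.+1 j n) * pull i.+1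
    + M * s (s (\sum_(n < N) Q i j n)) * s (pull i).
Proof.
rewrite big_ord_recl qshSS0 add0r !rmorph_sum mulr_sumr !mulr_suml -!big_split /=.
by apply: eq_bigr => n _; exact: qshSSS.
Qed.

(** Both sides obey the same recursion, once cuts are read as shifts on tensors of the right
    length. *)
Lemma qshuffle_atE i j N x : (i + j < N)%N -> homog (i + j) x ->
  qsh_at i j x = (\sum_(n < N) Q i j n) x.
Proof.
(* With an empty factor the product is the identity, which is the single component [n = k]. *)
have delta k N' y : (k < N')%N -> y = (\sum_(n < N') (n == k :> nat)%:R : wordop A) y.
  move=> lt_k; rewrite (bigD1 (Ordinal lt_k)) // eqxx wordop_addE.
  rewrite big1 ?addr0 // => n ne; rewrite (_ : (_ == _ :> nat) = false) //.
  exact/negbTE.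
elim: N i j x => // N IH [|i] [|j] x lt_N hx; try by apply: delta; lia.
have hr : homog (i.+1 + j.+1) (pull i.+1 x).
  rewrite addnS in hx *.
  have rp := prefix_op_widen (i := j) (prefix_op_pull sigma_lin i.+1).
  by have [] := rp _ 0 hx.
have hsr : homog (i.+1 + j.+1) (s (pull i) x).
  rewrite addnS in hx *.
  have sp := prefix_op_widen (i := j) (prefix_op_shift (prefix_op_pull sigma_lin i)).
  by have [] := sp _ 0 hx.
rewrite (sum_qshSSS i j N) (qshuffle_atSS i j x) 2!wordop_addE.
apply: (f_equal2 +%R); first apply: (f_equal2 +%R).
- apply: (tcut1_shift (lin_qshuffle_at i j.+1) _ hx) => y hy.
  by apply: IH hy; lia.
- rewrite (tcut_beta (k := j)); last by rewrite addSnnS.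
  rewrite addnS in hr; apply: (tcut1_shift (lin_qshuffle_at i.+1 j) _ hr) => y hy.
  by apply: IH hy; lia.
rewrite [RHS]wordop_mulE [RHS]wordop_mulE.
have -> : tcut 1 id (tcut i.+1 (beta_at sigma i 1) id) x = s (pull i) x.
  apply: (tcut1_shift _ (tcut_beta (k := j)) _).
    exact: lin_tcut (lin_beta_at i) (@lin_id _ _).
  by rewrite addSn -addnS.
rewrite addSn addnS in hsr.
apply: (tcut2_smul (lin_qshuffle_at i j) _ hsr) => y hy.
by apply: IH hy; lia.
Qed.

End QuasiShuffleOperators.

(** * The diamond product *)

Section TensorMaps.
Variable K : fieldType.

Lemma lin_tmull (V W : lmodType K) (v : V) : linear (@tmul K V W v).
Proof. by case: (@tmul_bilinear K V W) => _; apply. Qed.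

Lemma lin_tmulr (V W : lmodType K) (w : W) : linear (fun v : V => v ⊗ w).
Proof. by case: (@tmul_bilinear K V W) => + _; apply. Qed.

(** [tensor_mid] nests lifts, and the inner ones depend linearly on the outer vectors. *)
Lemma lin_tensor_lift_param (P V W Z : lmodType K) (F : P -> V -> W -> Z) x :
  (forall p, bilinear_map (F p)) -> (forall v w, linear (fun p => F p v w)) ->
  linear (fun p => tensor_lift (F p) x).
Proof.
move=> Fb Fl a p q; move: x.
apply: (@tensor_ext _ _ _ _ _
  (fun x => a *: tensor_lift (F p) x + tensor_lift (F q) x)) => [||v w].
- exact: tensor_lift_linear (Fb _).
- exact: (lin_add (lin_scale a (tensor_lift_linear (Fb p)))
           (tensor_lift_linear (Fb q))).
by rewrite !(tensor_lift_tmul (Fb _)) Fl.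
Qed.

Section Map.
Variables (V W V' W' : lmodType K) (f : V -> V') (g : W -> W').
Hypotheses (fl : linear f) (gl : linear g).

Let map_bilinear : bilinear_map (fun v w => f v ⊗ g w).
Proof.
split=> [w|v].
- exact: (lin_comp (lin_tmulr (g w)) fl).
- exact: (lin_comp (lin_tmull (f v)) gl).
Qed.

Lemma lin_tensor_map : linear (tensor_map f g).
Proof. exact: tensor_lift_linear map_bilinear. Qed.

Lemma tensor_map_tmul v w : tensor_map f g (v ⊗ w) = f v ⊗ g w.
Proof. exact: tensor_lift_tmul map_bilinear _ _. Qed.

End Map.

Section Mid.
Variables (U V W Z V' W' : lmodType K) (f : V ⊗ W -> V' ⊗ W').
Hypothesis fl : linear f.

Definition tensor_sandwich (u : U) (z : Z) : V' ⊗ W' -> (U ⊗ V') ⊗ (W' ⊗ Z) :=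
  tensor_lift (fun v' w' => (u ⊗ v') ⊗ (w' ⊗ z)).

Let sandwich_bilinear (u : U) (z : Z) :
  bilinear_map (fun (v' : V') (w' : W') => (u ⊗ v') ⊗ (w' ⊗ z)).
Proof.
split=> [w|v].
- exact: (lin_comp (lin_tmulr (w ⊗ z)) (lin_tmull u)).
- exact: (lin_comp (lin_tmull (u ⊗ v)) (lin_tmulr z)).
Qed.

Lemma lin_tensor_sandwich u z : linear (tensor_sandwich u z).
Proof. exact: tensor_lift_linear (sandwich_bilinear u z). Qed.

Lemma tensor_sandwich_tmul u z v w :
  tensor_sandwich u z (v ⊗ w) = (u ⊗ v) ⊗ (w ⊗ z).
Proof. exact: tensor_lift_tmul (sandwich_bilinear u z) _ _. Qed.

Lemma lin_tensor_sandwichl z x : linear (fun u => tensor_sandwich u z x).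
Proof.
apply: lin_tensor_lift_param => [u|v w]; first exact: sandwich_bilinear.
exact: (lin_comp (lin_tmulr (w ⊗ z)) (lin_tmulr v)).
Qed.

Lemma lin_tensor_sandwichr u x : linear (fun z => tensor_sandwich u z x).
Proof.
apply: lin_tensor_lift_param => [z|v w]; first exact: sandwich_bilinear.
exact: (lin_comp (lin_tmull (u ⊗ v)) (lin_tmull w)).
Qed.

Let right_bilinear u v :
  bilinear_map (fun w z => tensor_sandwich u z (f (v ⊗ w))).
Proof.
split=> [z|w]; last exact: lin_tensor_sandwichr.
exact: (lin_comp (lin_tensor_sandwich u z) (lin_comp fl (@lin_tmull V W v))).
Qed.

Let left_bilinear q :
  bilinear_map (fun u v => tensor_lift (fun w z => tensor_sandwich u z (f (v ⊗ w))) q).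
Proof.
split=> [v|u]; apply: lin_tensor_lift_param => [p|w z]; try exact: right_bilinear.
- exact: lin_tensor_sandwichl.
- exact: (lin_comp (lin_tensor_sandwich u z) (lin_comp fl (lin_tmulr w))).
Qed.

Let mid_bilinear :
  bilinear_map (fun p q => tensor_lift (fun (u : U) (v : V) =>
      tensor_lift (fun (w : W) (z : Z) => tensor_sandwich u z (f (v ⊗ w))) q) p).
Proof.
split=> [q|p]; first exact: tensor_lift_linear (left_bilinear q).
apply: lin_tensor_lift_param => [q|u v]; first exact: left_bilinear.
exact: tensor_lift_linear (right_bilinear u v).
Qed.

Lemma lin_tensor_mid : linear (@tensor_mid K U V W Z V' W' f).
Proof. exact: tensor_lift_linear mid_bilinear. Qed.

Lemma tensor_mid_tmul u v w z :
  tensor_mid f ((u ⊗ v) ⊗ (w ⊗ z)) = tensor_sandwich u z (f (v ⊗ w)).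
Proof.
apply: (etrans (tensor_lift_tmul mid_bilinear _ _)).
apply: (etrans (tensor_lift_tmul (left_bilinear _) _ _)).
exact: tensor_lift_tmul (right_bilinear u v) _ _.
Qed.

End Mid.
End TensorMaps.

(** * Splitting off the first letter *)

Section Letters.
Variables (K : fieldType) (A : lmodType K).
Local Notation T := (talg A).

(** Identifies tensors of positive length with [A ⊗ T], so that operators on words can describe the
    diamond product; scalars go to 0. *)
Definition uncons : T -> A ⊗ T :=
  talg_lift (fun s => if s is a :: t then a ⊗ word t else 0).

Let uncons_multilinear :
  multilinear (fun s : seq A => if s is a :: t then a ⊗ word t else 0).
Proof.
move=> [|c s1] s2 a x y; first exact: lin_tmulr.
by rewrite !cat_cons word_multilinear; exact: lin_tmull.
Qed.

Lemma lin_uncons : linear uncons.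
Proof. exact: talg_lift_linear uncons_multilinear. Qed.

Lemma uncons_word s : uncons (word s) = if s is a :: t then a ⊗ word t else 0.
Proof. exact: talg_lift_word uncons_multilinear _. Qed.

Lemma uncons_tcat1 a x : uncons (tcat (word [:: a]) x) = a ⊗ x.
Proof.
move: x; apply: talg_ext => [||s].
- exact: (lin_comp lin_uncons (lin_tcatl _)).
- exact: lin_tmull.
by rewrite tcat_word uncons_word.
Qed.

(** The images of nonempty words span [A ⊗ T]. *)
Lemma uncons_ext (Z : lmodType K) (g h : A ⊗ T -> Z) : linear g -> linear h ->
  (forall a s, g (uncons (word (a :: s))) = h (uncons (word (a :: s)))) -> g =1 h.
Proof.
move=> gl hl gh; apply: tensor_ext => // a x; move: x; apply: talg_ext => [||s].
- exact: (lin_comp gl (lin_tmull a)).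
- exact: (lin_comp hl (lin_tmull a)).
by have := gh a s; rewrite uncons_word.
Qed.

Let tpr1_multilinear :
  multilinear (fun s : seq A => if s is [:: a] then a else 0).
Proof.
move=> [|x1 s1] s2 a x y; first by case: s2 => // *; rewrite /= scaler0 addr0.
by case: s1 => [|x2 s1]; rewrite /= scaler0 addr0.
Qed.

Lemma lin_tpr1 : linear (@tpr1 K A).
Proof. exact: talg_lift_linear tpr1_multilinear. Qed.

Lemma tpr1_word s : tpr1 (word s) = if s is [:: a] then a else 0 :> A.
Proof. exact: talg_lift_word tpr1_multilinear _. Qed.

Let tsplit_multilinear n :
  multilinear (fun s : seq A => word (take n s) ⊗ word (drop n s)).
Proof.
move=> s1 s2 a x y; rewrite !take_cat !drop_cat; case: ltnP => _.
  by rewrite word_multilinear; exact: lin_tmull.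
case: (n - size s1)%N => [|k]; last by rewrite word_multilinear; exact: lin_tmulr.
by rewrite !take0 !drop0 (word_multilinear [::]); exact: lin_tmull.
Qed.

Lemma lin_tsplit n : linear (@tsplit K A n).
Proof. exact: talg_lift_linear (tsplit_multilinear n). Qed.

Lemma tsplit_word n s :
  tsplit n (word s) = word (take n s) ⊗ word (drop n s) :> T ⊗ T.
Proof. exact: talg_lift_word (tsplit_multilinear n) _. Qed.

Lemma tpr1_tsplit x : tensor_map tpr1 id (tsplit 1 x) = uncons x.
Proof.
have pl := lin_tensor_map lin_tpr1 (@lin_id K T).
move: x; apply: talg_ext => [||s].
- exact: (lin_comp pl (lin_tsplit 1)).
- exact: lin_uncons.
rewrite tsplit_word (tensor_map_tmul lin_tpr1 (@lin_id K T)) tpr1_word uncons_word.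
case: s => [|a s]; first by rewrite (lin0 (lin_tmulr _)).
by rewrite [take _ _]/= [drop _ _]/= take0 drop0.
Qed.

Section LiftCat.
Variables (Z : lmodType K) (F : nat -> nat -> T -> Z).
Hypothesis Fl : forall i j, linear (F i j).

Let lift_multilinear :
  (forall u : seq A, multilinear (fun v => F (size u) (size v) (word (u ++ v)))) /\
  (forall v : seq A, multilinear (fun u => F (size u) (size v) (word (u ++ v)))).
Proof.
split=> [u|v] s1 s2 a x y; rewrite !size_cat /=.
  by rewrite !catA word_multilinear Fl.
by rewrite -!catA !cat_cons word_multilinear Fl.
Qed.

Let lift_bilinear :
  bilinear_map (talg_lift2 (fun u v : seq A => F (size u) (size v) (word (u ++ v)))).
Proof. by case: lift_multilinear => *; exact: talg_lift2_bilinear. Qed.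

(** The common shape of [beta] and [qshuffle]. *)
Definition lift_cat : T ⊗ T -> Z := tensor_lift
  (talg_lift2 (fun u v : seq A => F (size u) (size v) (word (u ++ v)))).

Lemma lin_lift_cat : linear lift_cat.
Proof. exact: tensor_lift_linear lift_bilinear. Qed.

Lemma lift_cat_word u v :
  lift_cat (word u ⊗ word v) = F (size u) (size v) (word (u ++ v)).
Proof.
have [m1 m2] := lift_multilinear.
apply: (etrans (tensor_lift_tmul lift_bilinear _ _)).
rewrite /talg_lift2 talg_lift_word; first exact: talg_lift_word (m1 u) _.
by move=> s1 s2 a x y; rewrite !(talg_lift_word (m1 _)); exact: (m2 v).
Qed.

End LiftCat.

End Letters.

(** Associativity is known for each output length [p], while iterated products are grouped by the
    inner length [n]. *)
Lemma eq_exchange_sum (Z : nmodType) N P (F G : nat -> nat -> Z) :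
  (forall p, \sum_(n < N) F n p = \sum_(n < N) G n p) ->
  \sum_(n < N) \sum_(p < P) F n p = \sum_(n < N) \sum_(p < P) G n p.
Proof.
by move=> FG; rewrite exchange_big [RHS]exchange_big; apply: eq_bigr => p _.
Qed.

(** * The diamond product as an operator on words, and its associativity *)

Section Diamond.
Variables (K : fieldType) (A : lmodType K) (sigma : A ⊗ A -> A ⊗ A).
Variables (m : A ⊗ A -> A) (lambda : K).
Hypotheses (sigma_lin : linear sigma) (m_lin : linear m).
Local Notation T := (talg A).
Local Notation b := (braid_op sigma_lin).
Local Notation M' := (mul_op m_lin).
Local Notation M := (smul_op lambda m_lin).
Local Notation s := (@shift K A).
Local Notation pull := (pull s b).
Local Notation Q := (qsh s b M).
Local Notation lm := (fun z => lambda *: m z).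
Local Notation dia := (diamond m sigma lambda).

Lemma lin_beta_at_gen i j : linear (beta_at sigma i j).
Proof.
rewrite /beta_at /braid_perm; elim: (xget _ _) => [|k l IH]; first exact: lin_id.
have bl : linear (braid_at sigma k).
  by move=> a x y; rewrite !(braid_atE sigma_lin) wordop_linear.
exact: lin_comp bl IH.
Qed.

Let beta_piece_lin i j : linear (fun x => tsplit j (beta_at sigma i j x)).
Proof. exact: (lin_comp (@lin_tsplit K A j) (@lin_beta_at_gen i j)). Qed.

Lemma lin_beta : linear (beta sigma).
Proof. exact: (lin_lift_cat beta_piece_lin). Qed.

Lemma beta_word u v : beta sigma (word u ⊗ word v) =
  tsplit (size v) (beta_at sigma (size u) (size v) (word (u ++ v))).
Proof. exact: (lift_cat_word beta_piece_lin). Qed.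

Lemma lin_qshuffle : linear (qshuffle lm sigma).
Proof. exact: (lin_lift_cat (lin_qshuffle_at lambda sigma_lin m_lin)). Qed.

Lemma qshuffle_word u v : qshuffle lm sigma (word u ⊗ word v) =
  qshuffle_at lm sigma (size u) (size v) (word (u ++ v)).
Proof. exact: (lift_cat_word (lin_qshuffle_at lambda sigma_lin m_lin)). Qed.

Lemma lin_beta1 : linear (beta1 sigma).
Proof.
have l1 := lin_tensor_map (@lin_tpr1 K A) (@lin_id K T).
have l2 := lin_tensor_map (@lin_id K T) (@lin_tin1 K A).
exact: lin_comp l1 (lin_comp lin_beta l2).
Qed.

Lemma beta1_word u a : beta1 sigma (word u ⊗ a) = uncons (pull (size u) (word (u ++ [:: a]))).
Proof.
rewrite /beta1 /comp (tensor_map_tmul (@lin_id K T) (@lin_tin1 K A)).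
by rewrite beta_word tpr1_tsplit (beta_atE sigma_lin).
Qed.

Let mq_lin : linear (tensor_map m (qshuffle lm sigma)).
Proof. exact: lin_tensor_map m_lin lin_qshuffle. Qed.

Lemma lin_diamondl y : linear (fun x => dia x y).
Proof.
exact: (lin_comp mq_lin (lin_comp (@lin_tensor_mid _ _ _ _ _ _ _ _ lin_beta1) (lin_tmulr y))).
Qed.

Lemma lin_diamondr x : linear (dia x).
Proof.
exact: (lin_comp mq_lin (lin_comp (@lin_tensor_mid _ _ _ _ _ _ _ _ lin_beta1) (lin_tmull x))).
Qed.

(** The first letter of the second factor is brought next to that of the first, the tails are
    quasi-shuffled, and the two letters are multiplied. [M'] is unscaled, unlike the [M] inside
    [Q]. *)
Definition dia_op i j N : wordop A :=
  M' * s (s (\sum_(n < N) Q i j n)) * s (pull i).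

Lemma diamond_word a u c v N : (size u + size v < N)%N ->
  dia (uncons (word (a :: u))) (uncons (word (c :: v)))
  = uncons (dia_op (size u) (size v) N (word (a :: u ++ c :: v))).
Proof.
move=> lt_N; rewrite !uncons_word /diamond (tensor_mid_tmul lin_beta1) beta1_word.
set F := \sum_(n < N) Q (size u) (size v) n.
(* The rotated word is in general a combination of words, so the claim is made for all homogeneous
   [x]. *)
have key x : homog (size u).+1 x ->
    tensor_map m (qshuffle lm sigma) (tensor_sandwich a (word v) (uncons x))
    = uncons (M' (s (s F) (tcat (word [:: a]) (tcat x (word v))))).
  apply: (@homog_ext _ _ _
    (fun x => tensor_map m (qshuffle lm sigma) (tensor_sandwich a (word v) (uncons x)))
    (fun x => uncons (M' (s (s F) (tcat (word [:: a]) (tcat x (word v))))))).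
  - exact: (lin_comp mq_lin (lin_comp (lin_tensor_sandwich a (word v)) (@lin_uncons K A))).
  - apply: (lin_comp (@lin_uncons K A)); apply: (lin_comp (wordop_linear _)).
    apply: (lin_comp (wordop_linear _)).
    exact: (lin_comp (lin_tcatl _) (lin_tcatr _)).
  move=> t /size_eqS[d [w [-> wu]]].
  rewrite uncons_word tensor_sandwich_tmul (tensor_map_tmul m_lin lin_qshuffle).
  rewrite qshuffle_word 2!tcat_word 2!shift_cons tcatA tcat_word.
  rewrite pair_op_tcat uncons_tcat1.
  have hw : homog (size w + size v) (word (w ++ v)) by apply: homog_word; rewrite size_cat.
  by rewrite (qshuffle_atE lambda sigma_lin m_lin (N := N) _ hw) wu.
have hr : homog (size u).+1 (word (u ++ [:: c])).
  by apply: homog_word; rewrite size_cat addn1.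
have [hrr rE] := prefix_op_pull sigma_lin (size u) (word v) hr.
rewrite (key _ hrr) -rE tcat_word -catA /dia_op 2!wordop_mulE.
by rewrite shift_cons.
Qed.

Lemma diamond_uncons i j N x y : (i + j < N)%N -> homog i.+1 x -> homog j.+1 y ->
  dia (uncons x) (uncons y) = uncons (dia_op i j N (tcat x y)).
Proof.
move=> lt_N hx hy.
apply: (@homog_ext _ _ _ (fun x => dia (uncons x) (uncons y))
  (fun x => uncons (dia_op i j N (tcat x y))) _ _ _ _ _ hx).
- exact: (lin_comp (lin_diamondl _) (@lin_uncons K A)).
- exact: (lin_comp (@lin_uncons K A) (lin_comp (wordop_linear _) (lin_tcatr _))).
move=> t /size_eqS[a [u [-> ui]]].
apply: (@homog_ext _ _ _ (fun y => dia (uncons (word (a :: u))) (uncons y))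
  (fun y => uncons (dia_op i j N (tcat (word (a :: u)) y))) _ _ _ _ _ hy).
- exact: (lin_comp (lin_diamondr _) (@lin_uncons K A)).
- exact: (lin_comp (@lin_uncons K A) (lin_comp (wordop_linear _) (lin_tcatl _))).
move=> r /size_eqS[c [v [-> vj]]].
by rewrite tcat_word -ui -vj in lt_N *; exact: diamond_word.
Qed.

(** The component of output length [n.+1]: a tail of length [n] behind the product of two
    letters. *)
Definition dia_part i j n : wordop A := M' * s (s (Q i j n)) * s (pull i).

Lemma prefix_op_dia_part i j n :
  prefix_op (i.+1 + j.+1) n.+1 (dia_part i j n).
Proof.
apply: (@prefix_op_mul _ _ _ (i + j).+2).
  apply: (@prefix_op_mul _ _ _ n.+2).
    exact: (prefix_op_widen (i := n) (prefix_op_mul_op m_lin)).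
  exact: prefix_op_shift (prefix_op_shift (@prefix_op_qsh _ _ _ _ lambda sigma_lin m_lin i j n)).
rewrite addnS; apply: (prefix_op_widen (i := j) (n := i.+2) (k := i.+2)).
exact: prefix_op_shift (prefix_op_pull sigma_lin i).
Qed.

Lemma dia_op_sum i j N : dia_op i j N = \sum_(n < N) dia_part i j n.
Proof. by rewrite /dia_op !rmorph_sum mulr_sumr mulr_suml. Qed.

Lemma diamond_sum i j N x y : (i + j < N)%N -> homog i.+1 x -> homog j.+1 y ->
  dia (uncons x) (uncons y) = \sum_(n < N) uncons (dia_part i j n (tcat x y)).
Proof.
move=> lt_N hx hy; rewrite (diamond_uncons lt_N hx hy) dia_op_sum wordop_sumE.
exact: (lin_sum _ _ _ (@lin_uncons K A)).
Qed.

Hypothesis braided : is_braided_algebra m sigma.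

(** [mul_qsh_assoc] with the unscaled product outside, applied to the associativity of [Q], which
    contains the scaled one. *)
Lemma dia_part_assoc N i j k p : (i + j + k < N)%N ->
  \sum_(n < N) dia_part n k p * dia_part i j n
  = \sum_(n < N) dia_part i n p * iter i.+1 s (dia_part j k n).
Proof.
move=> lt_N.
have [_ _ br _ _] := braided.
have b2 := braid_op_shift2 sigma_lin.
have bb := braid_op_braid sigma_lin br.
have M2 := smul_op_shift2 lambda m_lin.
have Mb := smul_op_braid lambda sigma_lin m_lin braided.
have bM := braid_smul_op lambda sigma_lin m_lin braided.
have MM := smul_op_assoc lambda m_lin braided.
have M'b := mul_op_braid sigma_lin m_lin braided.
have M'M' := mul_op_assoc m_lin braided.
have qA := qsh_assoc b2 bb M2 Mb bM MM p lt_N.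
exact: (mul_qsh_assoc b2 bb M2 bM (mul_op_shift2 m_lin) M'b M'M' qA).
Qed.

Lemma diamond_assoc_homog i j k x y z :
  homog i.+1 x -> homog j.+1 y -> homog k.+1 z ->
  dia (uncons x) (dia (uncons y) (uncons z))
  = dia (dia (uncons x) (uncons y)) (uncons z).
Proof.
(* [N] bounds the tail lengths of the inner products and [P] those of the outer ones. *)
move=> hx hy hz; pose N := (i + j + k).+1; pose P := (N + i + k)%N.
have hxy : homog (i.+1 + j.+1) (tcat x y) by exact: homog_tcat.
have hyz : homog (j.+1 + k.+1) (tcat y z) by exact: homog_tcat.
have lt1 : (i + j < N)%N by rewrite /N; lia.
have lt2 : (j + k < N)%N by rewrite /N; lia.
rewrite (diamond_sum lt1 hx hy) (diamond_sum lt2 hy hz).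
rewrite (lin_sum _ _ _ (lin_diamondr _)) (lin_sum _ _ _ (lin_diamondl _)).
pose w := tcat x (tcat y z).
transitivity (\sum_(n < N) \sum_(p < P)
    uncons ((dia_part i n p * iter i.+1 s (dia_part j k n)) w)).
  apply: eq_bigr => n _.
  have [hn _] := @prefix_op_dia_part j k n _ 0 hyz.
  have ltP : (i + n < P)%N by have := ltn_ord n; rewrite /P; lia.
  rewrite (diamond_sum ltP hx hn); apply: eq_bigr => p _.
  by rewrite wordop_mulE (iter_shift_tcat _ _ hx).
transitivity (\sum_(n < N) \sum_(p < P)
    uncons ((dia_part n k p * dia_part i j n) w)); last first.
  apply: eq_bigr => n _.
  have [hn cat_n] := @prefix_op_dia_part i j n _ z hxy.
  have ltP : (n + k < P)%N by have := ltn_ord n; rewrite /P; lia.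
  rewrite (diamond_sum ltP hn hz); apply: eq_bigr => p _.
  by rewrite wordop_mulE /w tcatA cat_n.
apply: (@eq_exchange_sum _ N P
  (fun n p => uncons ((dia_part i n p * iter i.+1 s (dia_part j k n)) w))
  (fun n p => uncons ((dia_part n k p * dia_part i j n) w))) => p.
have dA := @dia_part_assoc N i j k p (ltnSn _).
have sumE (F : nat -> wordop A) :
    uncons ((\sum_(n < N) F n) w) = \sum_(n < N) uncons (F n w).
  by rewrite wordop_sumE; exact: (lin_sum _ _ _ (@lin_uncons K A)).
apply: etrans (esym (sumE (fun n => dia_part i n p * iter i.+1 s (dia_part j k n)))) _.
apply: etrans _ (sumE (fun n => dia_part n k p * dia_part i j n)).
exact: (congr1 (fun F : wordop A => uncons (F w)) (esym dA)).
Qed.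

Lemma diamond_algebra : is_algebra dia.
Proof.
split; first by split=> [y|x]; [exact: lin_diamondl | exact: lin_diamondr].
move=> x y z; move: x; apply: uncons_ext => [||a u].
- exact: lin_diamondl.
- exact: (lin_comp (lin_diamondl z) (lin_diamondl y)).
move: y; apply: uncons_ext => [||c v].
- exact: (lin_comp (lin_diamondr _) (lin_diamondl z)).
- exact: (lin_comp (lin_diamondl z) (lin_diamondr _)).
move: z; apply: uncons_ext => [||d w].
- exact: (lin_comp (lin_diamondr _) (lin_diamondr _)).
- exact: lin_diamondr.
by apply: diamond_assoc_homog; exact: homog_word (erefl _).
Qed.

End Diamond.

(** * The Rota-Baxter identity *)

Section RotaBaxter.
Variables (K : fieldType) (A : lmodType K) (sigma : A ⊗ A -> A ⊗ A).
Variables (m : A ⊗ A -> A) (oneA : A) (lambda : K).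
Hypotheses (sigma_lin : linear sigma) (m_lin : linear m).
Hypothesis mul1m : forall a, m (oneA ⊗ a) = a.
Hypothesis mulm1 : forall a, m (a ⊗ oneA) = a.
Hypothesis sigma_one_r : forall a, sigma (a ⊗ oneA) = oneA ⊗ a.
Local Notation T := (talg A).
Local Notation b := (braid_op sigma_lin).
Local Notation M' := (mul_op m_lin).
Local Notation M := (smul_op lambda m_lin).
Local Notation s := (@shift K A).
Local Notation pull := (pull s b).
Local Notation Q := (qsh s b M).
Local Notation dia := (diamond m sigma lambda).
Local Notation P := (rb_operator oneA).
Local Notation cons1 := (tcat (word [:: oneA])).
Local Notation dop := (dia_op lambda sigma_lin m_lin).

Lemma lin_rb_operator : linear P.
Proof.
apply: tensor_lift_linear; split=> [x|a].
- exact: (lin_comp (lin_tmull oneA) (lin_comp (lin_tcatr x) (@lin_tin1 K A))).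
- exact: (lin_comp (lin_tmull oneA) (lin_tcatl _)).
Qed.

(** Positive length matters: for the empty word the left side is 0 and the right side is [oneA ⊗
    word [::]]. *)
Lemma rb_operator_uncons i x : homog i.+1 x -> P (uncons x) = uncons (cons1 x).
Proof.
apply: (@homog_ext _ _ _ (fun x => P (uncons x)) (fun x => uncons (cons1 x))).
- exact: (lin_comp lin_rb_operator (@lin_uncons K A)).
- exact: (lin_comp (@lin_uncons K A) (lin_tcatl _)).
move=> t /size_eqS[a [u [-> _]]].
by rewrite uncons_word rb_operator_tmul uncons_tcat1 tcat_word.
Qed.

(** By [sigma_one_r] the unit passes each letter without changing it. *)
Lemma pull_one i x y : homog i x -> pull i (tcat x (cons1 y)) = cons1 (tcat x y).
Proof.
move=> hx; apply: (@homog_ext _ _ _ (fun x => pull i (tcat x (cons1 y)))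
  (fun x => cons1 (tcat x y)) _ _ _ _ _ hx).
- exact: (lin_comp (wordop_linear _) (lin_tcatr _)).
- exact: (lin_comp (lin_tcatl _) (lin_tcatr _)).
elim: i {x hx} => [|i IH] t; first by move=> /size0nil ->; rewrite pull0 !tcat_nil_l.
move=> /size_eqS[a [u [-> ui]]].
rewrite pullS wordop_mulE -[a :: u]cat1s -tcat_word.
rewrite -(tcatA (word [:: a]) (word u) (cons1 y)) shift_tcat1 (IH _ ui).
rewrite (tcatA (word [:: a]) (word [:: oneA])) tcat_word.
rewrite /braid_op pair_op_tcat sigma_one_r tin2_tmul.
by rewrite -(tcatA (word [:: a])) (tcatA (word [:: oneA]) (word [:: a])) tcat_word.
Qed.

Lemma mul_op_one_l F x i : homog i.+1 x -> M' (s (s F) (cons1 x)) = s F x.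
Proof.
apply: (@homog_ext _ _ _ (fun x => M' (s (s F) (cons1 x))) (s F)).
- exact: (lin_comp (wordop_linear _) (lin_comp (wordop_linear _) (lin_tcatl _))).
- exact: wordop_linear.
move=> t /size_eqS[a [u [-> _]]].
rewrite shift_tcat1 !shift_cons tcatA tcat_word pair_op_tcat.
by rewrite mul1m.
Qed.

Lemma mul_op_one_r F a x :
  M' (s (s F) (tcat (word [:: a]) (cons1 x))) = s F (tcat (word [:: a]) x).
Proof.
rewrite !shift_tcat1 tcatA tcat_word pair_op_tcat.
by rewrite mulm1.
Qed.

(** The unit is moved past the tail of [x] and absorbed by its first letter. *)
Lemma mul_op_pull_one F i x y : homog i.+1 x ->
  M' (s (s F) (s (pull i) (tcat x (cons1 y)))) = s F (tcat x y).
Proof.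
apply: (@homog_ext _ _ _ (fun x => M' (s (s F) (s (pull i) (tcat x (cons1 y)))))
  (fun x => s F (tcat x y))).
- apply: (lin_comp (wordop_linear _)); apply: (lin_comp (wordop_linear _)).
  exact: (lin_comp (wordop_linear _) (lin_tcatr _)).
- exact: (lin_comp (wordop_linear _) (lin_tcatr _)).
move=> t /size_eqS[a [u [-> ui]]].
rewrite -[a :: u]cat1s -tcat_word -(tcatA (word [:: a]) (word u) (cons1 y)).
rewrite shift_tcat1 (pull_one _ (homog_word ui)) mul_op_one_r.
by rewrite -(tcatA (word [:: a])).
Qed.

(** The components of the result have different lengths, all positive, so [rb_operator_uncons] is
    applied to each of them. *)
Lemma rb_operator_dia_op i j N z : homog (i.+1 + j.+1) z ->
  P (uncons (dop i j N z)) = uncons (cons1 (dop i j N z)).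
Proof.
move=> hz; rewrite dia_op_sum wordop_sumE.
rewrite (lin_sum _ _ _ (lin_comp lin_rb_operator (@lin_uncons K A))).
rewrite (lin_sum _ _ _ (lin_comp (@lin_uncons K A) (lin_tcatl (word [:: oneA])))).
apply: eq_bigr => n _.
have [hn _] := @prefix_op_dia_part _ _ _ _ lambda sigma_lin m_lin i j n _ 0 hz.
exact: rb_operator_uncons hn.
Qed.

Lemma dia_opE i j N z :
  dop i j N z = M' (s (s (\sum_(n < N) Q i j n)) (s (pull i) z)).
Proof. by []. Qed.

Lemma rota_baxter_words i j x y : homog i.+1 x -> homog j.+1 y ->
  dia (P (uncons x)) (P (uncons y))
  = P (dia (uncons x) (P (uncons y))) + P (dia (P (uncons x)) (uncons y))
    + lambda *: P (dia (uncons x) (uncons y)).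
Proof.
move=> hx hy; pose N := (i + j).+2.
have h1x : homog i.+2 (cons1 x).
  by rewrite -add1n; apply: homog_tcat hx; exact: homog_word.
have h1y : homog j.+2 (cons1 y).
  by rewrite -add1n; apply: homog_tcat hy; exact: homog_word.
have hxy : homog (i.+1 + j.+1) (tcat x y) by exact: homog_tcat.
have dE := diamond_uncons lambda sigma_lin m_lin.
rewrite (rb_operator_uncons hx) (rb_operator_uncons hy).
have lt0 : (i.+1 + j.+1 < N.+1)%N by rewrite /N; lia.
have lt1 : (i + j.+1 < N)%N by rewrite /N; lia.
have lt2 : (i.+1 + j < N)%N by rewrite /N; lia.
have lt3 : (i + j < N)%N by rewrite /N; lia.
pose L z := uncons (cons1 z).
have Ll : linear L := lin_comp (@lin_uncons K A) (lin_tcatl (word [:: oneA])).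
(* The second unit passes [x] and is absorbed by the first one; behind it stands the quasi-shuffle
   product of [x] and [y]. *)
have E0 : dop i.+1 j.+1 N.+1 (tcat (cons1 x) (cons1 y))
    = cons1 ((\sum_(n < N.+1) Q i.+1 j.+1 n) (tcat x y)).
  rewrite dia_opE -(tcatA (word [:: oneA]) x) shift_tcat1 (pull_one _ hx).
  have h1xy : homog (i.+1 + j.+1).+1 (cons1 (tcat x y)).
    by rewrite -add1n; apply: homog_tcat hxy; exact: homog_word.
  exact: etrans (mul_op_one_l _ h1xy) (shift_tcat1 _ _ _).
(* The first term of the recursion: the unit is absorbed by the first letter of [x], which stays in
   front. *)
have E1 : dop i j.+1 N (tcat x (cons1 y))
    = s (\sum_(n < N) Q i j.+1 n) (tcat x y).
  rewrite dia_opE; exact: (mul_op_pull_one (\sum_(n < N) Q i j.+1 n) y hx).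
(* The second term: the first letter of [y] passes [x] and absorbs the unit. *)
have E2 : dop i.+1 j N (tcat (cons1 x) y)
    = s (\sum_(n < N) Q i.+1 j n) (pull i.+1 (tcat x y)).
  rewrite dia_opE -(tcatA (word [:: oneA]) x) shift_tcat1.
  have hxy' : homog (i.+2 + j) (tcat x y) by rewrite addSnnS.
  have rp := prefix_op_widen (i := j) (prefix_op_pull sigma_lin i.+1).
  have [hr _] := rp _ 0 hxy'.
  exact: (@mul_op_one_l _ _ (i.+1 + j) hr).
have D0 : dia (uncons (cons1 x)) (uncons (cons1 y))
    = L ((\sum_(n < N.+1) Q i.+1 j.+1 n) (tcat x y)).
  apply: etrans (dE i.+1 j.+1 N.+1 _ _ lt0 h1x h1y) _.
  exact: (congr1 (@uncons K A) E0).
have D1 : P (dia (uncons x) (uncons (cons1 y)))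
    = L (s (\sum_(n < N) Q i j.+1 n) (tcat x y)).
  apply: etrans (congr1 P (dE i j.+1 N _ _ lt1 hx h1y)) _.
  apply: etrans (@rb_operator_dia_op i j.+1 N _ (homog_tcat hx h1y)) _.
  exact: (congr1 L E1).
have D2 : P (dia (uncons (cons1 x)) (uncons y))
    = L (s (\sum_(n < N) Q i.+1 j n) (pull i.+1 (tcat x y))).
  apply: etrans (congr1 P (dE i.+1 j N _ _ lt2 h1x hy)) _.
  apply: etrans (@rb_operator_dia_op i.+1 j N _ (homog_tcat h1x hy)) _.
  exact: (congr1 L E2).
have D3 : P (dia (uncons x) (uncons y)) = L (dop i j N (tcat x y)).
  exact: etrans (congr1 P (dE i j N _ _ lt3 hx hy)) (@rb_operator_dia_op i j N _ hxy).
have Lsum u v w : L (u + v + lambda *: w) = L u + L v + lambda *: L w.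
  by rewrite (linD _ _ Ll) (linD _ _ Ll) (linZ _ _ Ll).
(* [M] unfolds to [lambda] times [M'], so the third term of the recursion is
   [lambda *: dop i j N (tcat x y)]. *)
apply: etrans D0 _; rewrite (sum_qshSSS lambda sigma_lin m_lin i j N).
apply: etrans (Lsum _ _ _) _; apply: esym.
exact: (f_equal2 +%R (f_equal2 +%R D1 D2) (congr1 ( *:%R lambda) D3)).
Qed.

End RotaBaxter.

Theorem theorem2p4 (K : fieldType) (charK : [pchar K]%R =i pred0)
    (A : lmodType K) (m : A ⊗ A -> A) (oneA : A) (sigma : A ⊗ A -> A ⊗ A)
    (lambda : K) :
  is_unital_braided_algebra m oneA sigma ->
  is_rota_baxter lambda (diamond m sigma lambda) (rb_operator oneA).
Proof.
move=> [braided mul1 mulx1 sigma1 _].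
have [m_lin _ [sigma_lin _ _] _ _] := braided.
have Pl := @lin_rb_operator K A oneA.
have dl := lin_diamondl lambda sigma_lin m_lin.
have dr := lin_diamondr lambda sigma_lin m_lin.
split; [exact: diamond_algebra | exact: Pl |].
(* Both sides are linear in each argument, which reduces the identity to nonempty words. *)
move=> x y; move: x; apply: uncons_ext => [||a u].
- exact: (lin_comp (dl _) Pl).
- apply: lin_add; first apply: lin_add.
  + exact: (lin_comp Pl (dl _)).
  + exact: (lin_comp Pl (lin_comp (dl _) Pl)).
  + exact: (lin_scale lambda (lin_comp Pl (dl _))).
move: y; apply: uncons_ext => [||c v].
- exact: (lin_comp (dr _) Pl).
- apply: lin_add; first apply: lin_add.
  + exact: (lin_comp Pl (lin_comp (dr _) Pl)).
  + exact: (lin_comp Pl (dr _)).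
  + exact: (lin_scale lambda (lin_comp Pl (dr _))).
exact: (rota_baxter_words lambda sigma_lin m_lin mul1 mulx1 sigma1
  (homog_word (erefl (size (a :: u)))) (homog_word (erefl (size (c :: v))))).
Qed.
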